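(* Let $(M,F)$ be an $n$-dimensional complex Finsler space. The following assertions are equivalent: i) $(M,F)$ is generalized Berwald, i.e. the Berwald connection coefficients $\overset{B}{L}{}^i_{jk}$ depend only on the position $z$; ii) the spray coefficients $G^i$ are holomorphic in $\eta$, i.e. $\dot\partial_{\bar k}G^i=0$ on $\widetilde{T'M}$; iii) the Berwald connection $B\Gamma$ is of $(1,0)$-type.
   Context: Let $M$ be an $n$-dimensional complex manifold, $T'M$ its holomorphic tangent bundle with local coordinates $(z^k,\eta^k)$, and $\widetilde{T'M}=T'M\setminus\{0\}$ (zero section removed). A complex Finsler space $(M,F)$ is given by a continuous $F:T'M\to[0,\infty)$ with: $L:=F^2$ smooth on $\widetilde{T'M}$; $F(z,\eta)=0$ iff $\eta=0$; $F(z,\lambda\eta)=|\lambda|F(z,\eta)$ for $\lambda\in\mathbb C$; and the Hermitian matrix $g_{i\bar j}:=\partial^2L/\partial\eta^i\partial\bar\eta^j$ positive definite. $(g^{\bar j i})$ is the inverse matrix, $g^{\bar j i}g_{k\bar j}=\delta^i_k$. Notation: $\dot\partial_k=\partial/\partial\eta^k$, $\dot\partial_{\bar k}=\partial/\partial\bar\eta^k$; summation convention. Set $N^i_j:=g^{\bar mi}\frac{\partial g_{l\bar m}}{\partial z^j}\eta^l$, spray coefficients $G^i:=\tfrac12N^i_j\eta^j$, $\overset{c}{N}{}^i_j:=\dot\partial_jG^i$. The Berwald connection is $B\Gamma:=(\overset{c}{N}{}^i_j,\overset{B}{L}{}^i_{jk},\overset{B}{L}{}^i_{j\bar k},0,0)$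 with $\overset{B}{L}{}^i_{jk}:=\dot\partial_k\overset{c}{N}{}^i_j$, $\overset{B}{L}{}^i_{j\bar k}:=\dot\partial_{\bar k}\overset{c}{N}{}^i_j$. It is of $(1,0)$-type if its mixed coefficients vanish: $\overset{B}{L}{}^i_{j\bar k}=0$ on $\widetilde{T'M}$. *)

(* Defs.v *)
From HB Require Import structures.
From mathcomp Require Import all_boot all_order all_algebra.
From mathcomp Require Import complex.
From mathcomp Require Import all_classical all_reals all_analysis.
Set Implicit Arguments.
Unset Strict Implicit.
Unset Printing Implicit Defensive.
Import Order.TTheory GRing.Theory Num.Theory numFieldNormedType.Exports.
Local Open Scope classical_set_scope.
Local Open Scope ring_scope.
Local Open Scope complex_scope.

(* MathComp-Analysis attaches its topology to abstract number fields; R[i] gets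
   the topology of its own modulus, and then [differentiable] between spaces
   over R[i] is complex (Frechet) differentiability, i.e. holomorphy. *)
HB.instance Definition _ (R : rcfType) :=
  NormedModule.copy R[i] (R[i] : numClosedFieldType).

Section WirtingerCalculus.
Context {R : realType} {V : normedModType R[i]}.
Implicit Types (f : V -> R[i]) (v x : V).

Definition real_derivable v f x :=
  derivable (fun t : R => complex.Re (f (x + t%:C *: v))) 0 1 /\
  derivable (fun t : R => complex.Im (f (x + t%:C *: v))) 0 1.

Definition real_derive v f x : R[i] :=
  derive1 (fun t : R => complex.Re (f (x + t%:C *: v))) 0 +i*
  derive1 (fun t : R => complex.Im (f (x + t%:C *: v))) 0.

(* C^oo in the underlying real coordinates: every iterated real directional
   derivative exists and is continuous. It is meant for open U. *)
Definition smooth_on (U : set V) f :=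
  forall (ds : seq V) x, U x ->
    {for x, continuous (foldr real_derive f ds)} /\
    forall v, real_derivable v (foldr real_derive f ds) x.

(* With w = s + i t the complex coordinate along v, d/dw = (d/ds - i d/dt)/2
   and d/d(conj w) = (d/ds + i d/dt)/2. *)
Definition wirtinger v f x : R[i] :=
  (real_derive v f x - 'i * real_derive ('i *: v) f x) / 2.

Definition wirtinger_bar v f x : R[i] :=
  (real_derive v f x + 'i * real_derive ('i *: v) f x) / 2.

End WirtingerCalculus.

(* The atlas is any holomorphic atlas, possibly the maximal one. The maps are
   total functions; [chart_inv a] is relevant on [chart a @` chart_dom a] only. *)
Record complexManifold (R : realType) (n : nat) := ComplexManifold {
  carrier :> topologicalType;
  manifold_hausdorff : hausdorff_space carrier;
  manifold_second_countable : @second_countable carrier;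
  atlas : Type;
  chart_dom : atlas -> set carrier;
  chart : atlas -> carrier -> 'rV[R[i]]_n;
  chart_inv : atlas -> 'rV[R[i]]_n -> carrier;
  chart_cover : forall p, exists a, chart_dom a p;
  chart_dom_open : forall a, open (chart_dom a);
  chart_image_open : forall a, open (chart a @` chart_dom a);
  chartK : forall a p, chart_dom a p -> chart_inv a (chart a p) = p;
  chart_continuous : forall a p, chart_dom a p -> {for p, continuous (chart a)};
  chart_inv_continuous : forall a p, chart_dom a p ->
    {for chart a p, continuous (chart_inv a)};
  chart_holomorphic : forall a b p, chart_dom a p -> chart_dom b p ->
    differentiable (chart b \o chart_inv a) (chart a p) }.

Lemma diff_comp_at {K : numFieldType} {U V W : normedModType K}
    (f : U -> V) (g : V -> W) x y v :
  y = f x -> differentiable f x -> differentiable g y ->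
  'D_v (g \o f) x = 'd g y ('d f x v).
Proof.
move=> -> df dg; rewrite deriveE; last exact: differentiable_comp.
by rewrite diff_comp.
Qed.

Section HolomorphicTangentBundle.
Context {R : realType} {n : nat} {M : complexManifold R n}.

Definition chart_image (a : atlas M) : set 'rV[R[i]]_n :=
  chart a @` chart_dom a.

Definition transition_diff (a b : atlas M) (p : M) :
    'rV[R[i]]_n -> 'rV[R[i]]_n :=
  'd (chart b \o chart_inv a) (chart a p).

(* An element of T'M, as the family of its components eta in all the charts
   around its base point, with the transformation law
   eta_b = (d z_b / d z_a) eta_a. Components in the other charts carry no
   information and are set to 0. *)
Record tangent := Tangent {
  tangent_base : M;
  tangent_comp : atlas M -> 'rV[R[i]]_n;
  tangent_comp_out : forall a, ~ chart_dom a tangent_base ->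
    tangent_comp a = 0;
  tangent_compE : forall a b, chart_dom a tangent_base ->
    chart_dom b tangent_base ->
    tangent_comp b = transition_diff a b tangent_base (tangent_comp a) }.

Lemma chart_inv_dom (a : atlas M) z :
  chart_image a z -> chart_dom a (chart_inv a z).
Proof. by move=> [p ap <-]; rewrite chartK. Qed.

Lemma chart_invK (a : atlas M) z :
  chart_image a z -> chart a (chart_inv a z) = z.
Proof. by move=> [p ap <-]; rewrite chartK. Qed.

Lemma transition_dom_near (a b : atlas M) (p : M) :
  chart_dom a p -> chart_dom b p ->
  \forall z \near chart a p, chart_dom b (chart_inv a z).
Proof.
move=> ap bp; apply: (chart_inv_continuous ap).
by rewrite chartK//; apply: open_nbhs_nbhs; split => //; exact: chart_dom_open.
Qed.

Lemma chart_image_near (a : atlas M) (p : M) :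
  chart_dom a p -> \forall z \near chart a p, chart_image a z.
Proof.
move=> ap; apply: open_nbhs_nbhs; split; first exact: chart_image_open.
by exists p.
Qed.

Lemma transition_diff_id (a : atlas M) (p : M) v :
  chart_dom a p -> transition_diff a a p v = v.
Proof.
move=> ap; rewrite /transition_diff -deriveE; last exact: chart_holomorphic.
have -> : 'D_v (chart a \o chart_inv a) (chart a p) = 'D_v id (chart a p).
  apply: near_eq_derive; near=> z => /=.
  by rewrite chart_invK //; near: z; exact: chart_image_near.
by rewrite deriveE // diff_val.
Unshelve. all: by end_near. Qed.

Lemma transition_diff_comp (a b c : atlas M) (p : M) v :
  chart_dom a p -> chart_dom b p -> chart_dom c p ->
  transition_diff b c p (transition_diff a b p v) = transition_diff a c p v.
Proof.
move=> ap bp cp; rewrite /transition_diff.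
have dab := chart_holomorphic ap bp; have dbc := chart_holomorphic bp cp.
have pE : chart b p = (chart b \o chart_inv a) (chart a p).
  by rewrite /= chartK.
apply: etrans (esym (diff_comp_at v pE dab dbc)) _.
apply: etrans (deriveE v (chart_holomorphic ap cp)).
apply: near_eq_derive; near=> z.
rewrite /comp chartK //; near: z; exact: transition_dom_near.
Unshelve. all: by end_near. Qed.

Section TangentAt.
Context (a : atlas M) (p : M) (ap : chart_dom a p) (eta : 'rV[R[i]]_n).

Definition tangent_at_comp (b : atlas M) : 'rV[R[i]]_n :=
  if `[< chart_dom b p >] then transition_diff a b p eta else 0.

Fact tangent_at_out b : ~ chart_dom b p -> tangent_at_comp b = 0.
Proof. by move=> bp; rewrite /tangent_at_comp asboolF. Qed.

Fact tangent_atE b c : chart_dom b p -> chart_dom c p ->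
  tangent_at_comp c = transition_diff b c p (tangent_at_comp b).
Proof.
by move=> bp cp; rewrite /tangent_at_comp !asboolT // transition_diff_comp.
Qed.

(* the tangent vector eta^k d/dz^k at p, in the chart a *)
Definition tangent_at : tangent := Tangent tangent_at_out tangent_atE.

Lemma tangent_at_compE : tangent_comp tangent_at a = eta.
Proof. by rewrite /= /tangent_at_comp asboolT // transition_diff_id. Qed.

End TangentAt.

(* f read in the local coordinates (z, eta) of T'M induced by the chart a *)
Definition local_expr (f : tangent -> R) (a : atlas M)
    (x : 'rV[R[i]]_n * 'rV[R[i]]_n) : R :=
  if pselect (chart_image a x.1) is left ax
  then f (tangent_at (chart_inv_dom ax) x.2) else 0.

Definition finsler_L (f : tangent -> R) (a : atlas M)
    (x : 'rV[R[i]]_n * 'rV[R[i]]_n) : R := local_expr f a x ^+ 2.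

(* the coordinate domain of T'M minus the zero section over the chart a *)
Definition slit (a : atlas M) : set ('rV[R[i]]_n * 'rV[R[i]]_n) :=
  [set x | chart_image a x.1 /\ x.2 != 0].

End HolomorphicTangentBundle.
Arguments tangent {R n} M.

Section ChernFinslerGeometry.
Context {R : realType} {n : nat}.
Local Notation V := ('rV[R[i]]_n * 'rV[R[i]]_n)%type.
Implicit Types (f : V -> R[i]) (L : V -> R) (x : V).

Definition d_z (k : 'I_n) f : V -> R[i] := wirtinger (delta_mx 0 k, 0) f.
Definition d_eta (k : 'I_n) f : V -> R[i] := wirtinger (0, delta_mx 0 k) f.
Definition d_etabar (k : 'I_n) f : V -> R[i] :=
  wirtinger_bar (0, delta_mx 0 k) f.

Definition metric L x : 'M[R[i]]_n :=
  \matrix_(i, j) d_eta i (d_etabar j (fun y => (L y)%:C)) x.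

(* [metric_inv L x j i] is g^{jbar i}, as g^{jbar i} g_{k jbar} = delta^i_k
   is [metric L x *m metric_inv L x = 1]. *)
Definition metric_inv L x : 'M[R[i]]_n := invmx (metric L x).

Definition N_coef L (i j : 'I_n) x : R[i] :=
  \sum_m \sum_l
    metric_inv L x m i * d_z j (fun y => metric L y l m) x * x.2 0 l.

Definition spray L (i : 'I_n) x : R[i] :=
  2^-1 * \sum_j N_coef L i j x * x.2 0 j.

Definition Nc_coef L (i j : 'I_n) : V -> R[i] := d_eta j (spray L i).

Record connection := Connection {
  nonlinear_coef : 'I_n -> 'I_n -> V -> R[i];
  horizontal_coef : 'I_n -> 'I_n -> 'I_n -> V -> R[i];
  horizontal_mixed_coef : 'I_n -> 'I_n -> 'I_n -> V -> R[i];
  vertical_coef : 'I_n -> 'I_n -> 'I_n -> V -> R[i];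
  vertical_mixed_coef : 'I_n -> 'I_n -> 'I_n -> V -> R[i] }.

Definition berwald_connection L : connection := {|
  nonlinear_coef := Nc_coef L;
  horizontal_coef := fun i j k => d_eta k (Nc_coef L i j);
  horizontal_mixed_coef := fun i j k => d_etabar k (Nc_coef L i j);
  vertical_coef := fun _ _ _ _ => 0;
  vertical_mixed_coef := fun _ _ _ _ => 0 |}.

Definition type10_on (U : set V) (D : connection) :=
  forall i j k x, U x -> horizontal_mixed_coef D i j k x = 0.

End ChernFinslerGeometry.

(* Continuity and smoothness on T'M are read in the induced coordinates. *)
Record complexFinsler {R : realType} {n : nat} (M : complexManifold R n) :=
  ComplexFinsler {
  finsler_fun :> tangent M -> R;
  finsler_ge0 : forall v, 0 <= finsler_fun v;
  finsler_continuous : forall a z eta, chart_image a z ->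
    {for (z, eta), continuous (local_expr finsler_fun a)};
  finsler_smooth : forall a,
    smooth_on (slit a) (fun x => (finsler_L finsler_fun a x)%:C);
  finsler_eq0 : forall a z eta, chart_image a z ->
    local_expr finsler_fun a (z, eta) = 0 <-> eta = 0;
  finsler_homogeneous : forall a z eta (lambda : R[i]), chart_image a z ->
    (local_expr finsler_fun a (z, lambda *: eta))%:C =
    `|lambda| * (local_expr finsler_fun a (z, eta))%:C;
  finsler_posdef : forall a x, slit a x ->
    forall v : 'rV[R[i]]_n, v != 0 ->
    0 < \sum_i \sum_j
      metric (finsler_L finsler_fun a) x i j * v 0 i * (v 0 j)^* }.

Section GeneralizedBerwald.
Context {R : realType} {n : nat} {M : complexManifold R n}.
Implicit Type F : complexFinsler M.

Definition generalized_berwald F :=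
  forall (a : atlas M) i j k z eta eta', slit a (z, eta) -> slit a (z, eta') ->
    horizontal_coef (berwald_connection (finsler_L F a)) i j k (z, eta) =
    horizontal_coef (berwald_connection (finsler_L F a)) i j k (z, eta').

Definition spray_holomorphic_in_eta F :=
  forall (a : atlas M) i k x, slit a x ->
    d_etabar k (spray (finsler_L F a) i) x = 0.

Definition berwald_connection_type10 F :=
  forall a : atlas M, type10_on (slit a) (berwald_connection (finsler_L F a)).

End GeneralizedBerwald.

(* Main.v *)
From HB Require Import structures.
From mathcomp Require Import all_boot all_order all_algebra.
From mathcomp Require Import complex.
From mathcomp Require Import all_classical all_reals all_analysis.
From mathcomp Require Import ring lra.
Require Import Defs.
Set Implicit Arguments.
Unset Strict Implicit.
Unset Printing Implicit Defensive.
Import Order.TTheory GRing.Theory Num.Theory numFieldNormedType.Exports.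
Local Open Scope classical_set_scope.
Local Open Scope ring_scope.
Local Open Scope complex_scope.

(** Idea. The metric is homogeneous of degree 0 in eta, so the spray
    coefficients G^i are homogeneous of degree 2, and Euler's identity gives
    2 G^i = eta^j d_j G^i and d_j G^i = eta^k d_k d_j G^i.
    - (ii) => (iii): d_j and d_kbar commute.
    - (iii) => (ii), and likewise (i) => (iii): differentiate Euler's identity,
      eta^j being holomorphic.
    - (ii) => (i): h = d_k d_j G^i is holomorphic in eta and homogeneous of
      degree 0. For independent eta, eta', the entire function
      w |-> h(eta + w eta') = h(eta / w + eta') tends to h(eta') at infinity,
      hence is constant by the maximum principle, so h(eta) = h(eta').
    The maximum principle, the symmetry of second derivatives and the
    additivity of the derivative in the direction all rest on the mean value
    theorem in one real variable. *)

(** * Functions of two real variables *)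

(** The mean value theorem based at 0; bounding [c] by [|t|] gives one statement for both signs of
    [t] and for [t = 0]. *)
Lemma mvt0 (R : realType) (f df : R -> R) (t : R) :
  (forall x : R, `|x| <= `|t| -> is_derive x 1 f (df x)) ->
  exists2 c, `|c| <= `|t| & f t - f 0 = df c * t.
Proof.
move=> fdf.
have fcont (a b : R) : (forall x, x \in `[a, b] -> `|x| <= `|t|) ->
    {within `[a, b], continuous f}.
  by move=> abt; apply: derivable_within_continuous => x /abt/fdf[].
have oo (a b x : R) : x \in `]a, b[ -> x \in `[a, b].
  by rewrite !in_itv /= => /andP[/ltW -> /ltW ->].
have [t0|t0|->] := ltrgt0P t.
- have abt x : x \in `[0, t] -> `|x| <= `|t|.
    by rewrite in_itv /= => /andP[? ?]; rewrite !ger0_norm // ltW.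
  have [|c /oo/abt cab] := @MVT _ f df 0 t t0 _ (fcont _ _ abt).
    by move=> x /oo/abt/fdf.
  by rewrite subr0 => ->; exists c => //; rewrite -[leRHS]gtr0_norm.
- have abt x : x \in `[t, 0] -> `|x| <= `|t|.
    by rewrite in_itv /= => /andP[? ?]; rewrite !ler0_norm ?lerN2 // ltW.
  have [|c /oo/abt cab] := @MVT _ f df t 0 t0 _ (fcont _ _ abt).
    by move=> x /oo/abt/fdf.
  rewrite sub0r => E; exists c; first by rewrite -[leRHS]ltr0_norm.
  by rewrite -[LHS]opprB E mulrN opprK.
- by exists 0; rewrite ?normr0 // subrr mulr0.
Qed.

(** The epsilon-delta form of the derivative at 0, in which the estimates of [derive_diag] and
    [second_derivative_max] are made. *)
Lemma is_derive0P (R : realType) (f : R -> R) (l : R) :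
  is_derive (0 : R) 1 f l <->
  forall e, 0 < e -> exists2 d, 0 < d & forall h, h != 0 -> `|h| < d ->
    `|(f h - f 0) / h - l| < e.
Proof.
have E (h : R) : h^-1 *: ((f \o shift 0) (h *: 1) - f 0) = (f h - f 0) / h.
  by rewrite /= addr0 /GRing.scale /= mulr1 mulrC.
split=> [[df fl]|fl].
- move=> e e0.
  have : h^-1 *: ((f \o shift 0) (h *: 1) - f 0) @[h --> 0^'] --> l.
    by rewrite -fl; exact: df.
  move=> /cvgrPdist_lt /(_ _ e0) [d /= d0 dl]; exists d => // h h0 hd.
  by rewrite -E distrC; apply: dl => //=; rewrite sub0r normrN.
- have fcv : h^-1 *: ((f \o shift 0) (h *: 1) - f 0) @[h --> 0^'] --> l.
    apply/cvgrPdist_lt => e /fl[d d0 dl]; exists d => //= h.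
    by rewrite /= sub0r normrN => hd h0; rewrite distrC E; exact: dl.
  by apply: DeriveDef; [apply/cvg_ex; exists l|exact/cvg_lim].
Qed.

Section two_variables.
Context {R : realType}.
Implicit Types (phi : R -> R -> R) (e s t : R).

(** Two mean value steps: first in s for the difference of [phi] between heights e and 0, then in t
    for [phi1] at the intermediate abscissa. *)
Lemma rect_mvt phi phi1 phi12 e : 0 <= e ->
  (forall s t, `|s| <= e -> `|t| <= e ->
    is_derive s 1 (phi^~ t) (phi1 s t)) ->
  (forall s t, `|s| <= e -> `|t| <= e ->
    is_derive t 1 (phi1 s) (phi12 s t)) ->
  exists s t, [/\ `|s| <= e, `|t| <= e &
    phi e e - phi e 0 - (phi 0 e - phi 0 0) = phi12 s t * e ^+ 2].
Proof.
move=> e0 d1 d12.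
have ee : `|e| = e by rewrite ger0_norm.
have e00 : `|0 : R| <= e by rewrite normr0.
have [s|s] := @mvt0 _ (fun s => phi s e - phi s 0)
  (fun s => phi1 s e - phi1 s 0) e.
  by rewrite ee => se; apply: is_deriveB; apply: d1; rewrite ?ee.
rewrite ee => se ->.
have [t|t] := @mvt0 _ (phi1 s) (phi12 s) e.
  by rewrite ee => te; exact: d12.
rewrite ee => te ->.
by exists s, t; split => //; rewrite expr2 mulrA.
Qed.

Lemma box_continuous (f : R * R -> R) : {for (0, 0), continuous f} ->
  forall d, 0 < d -> exists2 e, 0 < e &
  forall s t, `|s| < e -> `|t| < e -> `|f (s, t) - f (0, 0)| < d.
Proof.
move=> /cvgrPdist_lt cf d /cf /nbhs_ballP[e /= e0 fe]; exists e => // s t se te.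
by rewrite distrC; apply: fe; split; rewrite -ball_normE /= sub0r normrN.
Qed.

(** Schwarz's theorem at the origin: the two mixed derivatives take a common value at two points of
    a small square, and each is there within [del / 2] of its value at the origin. *)
Lemma mixed_partials phi phi1 phi2 phi12 phi21 e : 0 < e ->
  (forall s t, `|s| < e -> `|t| < e ->
    [/\ is_derive s 1 (phi^~ t) (phi1 s t), is_derive t 1 (phi s) (phi2 s t),
        is_derive t 1 (phi1 s) (phi12 s t) &
        is_derive s 1 (phi2^~ t) (phi21 s t)]) ->
  {for (0, 0), continuous (fun p => phi12 p.1 p.2)} ->
  {for (0, 0), continuous (fun p => phi21 p.1 p.2)} ->
  phi12 0 0 = phi21 0 0.
Proof.
move=> e0 d c12 c21.
apply/eqP; rewrite -subr_eq0 -normr_le0; apply/ler_addgt0Pl => del del0.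
rewrite addr0; have del2 : 0 < del / 2 by rewrite divr_gt0.
have [e1 e10 {}c12] := box_continuous c12 del2.
have [e2 e20 {}c21] := box_continuous c21 del2.
pose r := Num.min e (Num.min e1 e2) / 2.
have m0 : 0 < Num.min e (Num.min e1 e2) by rewrite !lt_min e0 e10.
have r0 : 0 < r by rewrite divr_gt0.
have rlt : r < Num.min e (Num.min e1 e2) by rewrite /r; lra.
move: rlt; rewrite !lt_min => /and3P[re re1 re2].
have re' s : `|s| <= r -> `|s| < e by move=> /le_lt_trans; apply.
(* Both mixed derivatives compute the second difference of phi on [0, r]^2. *)
have [||s1 [t1 [s1r t1r E1]]] := @rect_mvt phi phi1 phi12 r (ltW r0).
- by move=> s t /re' se /re' te; case: (d _ _ se te).
- by move=> s t /re' se /re' te; case: (d _ _ se te).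
have [||t2 [s2 [t2r s2r E2]]] :=
    @rect_mvt (fun t s => phi s t) (fun t s => phi2 s t)
    (fun t s => phi21 s t) r (ltW r0).
- by move=> s t /re' se /re' te; case: (d _ _ te se).
- by move=> s t /re' se /re' te; case: (d _ _ te se).
have E : phi12 s1 t1 = phi21 s2 t2.
  have r20 : r ^+ 2 != 0 by rewrite expf_neq0 // gt_eqF.
  by apply: (mulIf r20); rewrite -E1 -E2; lra.
have h1 := c12 s1 t1 (le_lt_trans s1r re1) (le_lt_trans t1r re1).
have h2 := c21 s2 t2 (le_lt_trans s2r re2) (le_lt_trans t2r re2).
rewrite -E in h2; move: h1 h2; rewrite !ltr_norml => /andP[? ?] /andP[? ?].
rewrite ler_norml; lra.
Qed.

(** Chain rule along the diagonal. The increment splits into one along the first axis, governed by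
    [l], and one in the second variable, which the mean value theorem writes as [phi2 h t * h] with
    t between 0 and h. *)
Lemma derive_diag phi phi2 (l : R) e : 0 < e ->
  (forall s t, `|s| < e -> `|t| < e -> is_derive t 1 (phi s) (phi2 s t)) ->
  is_derive (0 : R) 1 (phi^~ 0) l ->
  {for (0, 0), continuous (fun p => phi2 p.1 p.2)} ->
  is_derive (0 : R) 1 (fun t => phi t t) (l + phi2 0 0).
Proof.
move=> e0 d2 /is_derive0P d1 c2; apply/is_derive0P => del del0.
have del2 : 0 < del / 2 by rewrite divr_gt0.
have [e1 e10 {}d1] := d1 _ del2.
have [e2 e20 {}c2] := box_continuous c2 del2.
exists (Num.min e (Num.min e1 e2)); first by rewrite !lt_min e0 e10.
move=> h h0; rewrite !lt_min => /and3P[he he1 he2].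
have [|t th E] := @mvt0 _ (phi h) (phi2 h) h.
  by move=> x xh; apply: d2 => //; exact: le_lt_trans he.
have := c2 h t he2 (le_lt_trans th he2).
have := d1 h h0 he1.
have -> : phi h h - phi 0 0 = (phi h 0 - phi 0 0) + (phi h h - phi h 0) by lra.
rewrite E (mulrDl _ (_ * _)) mulfK // !ltr_norml => /andP[? ?] /andP[? ?]; lra.
Qed.
End two_variables.

(** * Complex-valued curves *)

Section complex_topology.
Context {R : realType}.
Local Notation Re := (@complex.Re R).
Local Notation Im := (@complex.Im R).

Lemma Re_continuous : continuous (Re : R[i] -> R).
Proof.
move=> z; apply/(@cvgrPdist_lt _ _ _ (nbhs z)) => e e0.
apply/nbhs_ballP; exists e%:C; first by rewrite /= ltcR.
move=> y; rewrite -ball_normE /= => zy.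
have : `|Re (z - y)|%:C < e%:C by apply: le_lt_trans zy; exact: normc_ge_Re.
by rewrite ltcR raddfB.
Qed.

(** Multiplication by 'i preserves the modulus and turns the imaginary part into the real part, up
    to sign. *)
Lemma normc_ge_Im (z : R[i]) : `|Im z|%:C <= `|z|.
Proof.
have -> : `|z| = `|z * 'i|.
  by rewrite normrM [X in _ * X]normc_def /= expr0n expr1n add0r sqrtr1 mulr1.
by rewrite -normrN -ReiNIm; exact: normc_ge_Re.
Qed.

Lemma Im_continuous : continuous (Im : R[i] -> R).
Proof.
move=> z; apply/(@cvgrPdist_lt _ _ _ (nbhs z)) => e e0.
apply/nbhs_ballP; exists e%:C; first by rewrite /= ltcR.
move=> y; rewrite -ball_normE /= => zy.
have : `|Im (z - y)|%:C < e%:C by apply: le_lt_trans zy; exact: normc_ge_Im.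
by rewrite ltcR raddfB.
Qed.

Lemma real_complex_continuous : continuous (fun t : R => t%:C : R[i]).
Proof.
(* A positive [e] of [R[i]] has imaginary part 0, so its real part can serve as the radius on the
   real line. *)
move=> t; apply/cvgrPdist_lt => e; rewrite ltcE /= => /andP[/eqP e_im e0].
apply/nbhs_ballP; exists (Re e) => // s /= ts.
by rewrite -rmorphB /= normc_def /= expr0n addr0 sqrtr_sqr ltcE /= e_im ts eqxx.
Qed.

End complex_topology.

Section curves.
Context {R : realType}.
Local Notation Re := (@complex.Re R).
Local Notation Im := (@complex.Im R).
Implicit Types (c d : R -> R[i]) (t : R) (k l m : R[i]).

(** Taken by components, to match [real_derivable] and [real_derive]; it asserts existence and value
    at once. *)
Definition is_cderive t c l :=
  is_derive t 1 (fun s => Re (c s)) (Re l) /\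
  is_derive t 1 (fun s => Im (c s)) (Im l).

Lemma is_cderive_unique t c l m : is_cderive t c l -> is_cderive t c m -> l = m.
Proof.
move=> [[_ lr] [_ li]] [[_ mr] [_ mi]].
by apply/eqP; rewrite eq_complex -lr -li -mr -mi !eqxx.
Qed.

Lemma is_cderive_near t c d l : (\forall s \near t, c s = d s) ->
  is_cderive t c l -> is_cderive t d l.
Proof.
by move=> cd [lr li]; split; [apply: near_eq_is_derive lr|
  apply: near_eq_is_derive li]; apply: filterS cd => s ->.
Qed.

Lemma is_cderive_cst t k : is_cderive t (fun=> k) 0.
Proof. by split; exact: is_derive_cst. Qed.

Lemma is_cderiveD t c d l m : is_cderive t c l -> is_cderive t d m ->
  is_cderive t (fun s => c s + d s) (l + m).
Proof.
move=> [lr li] [mr mi]; split; rewrite raddfD.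
  by under eq_fun do rewrite raddfD; exact: is_deriveD.
by under eq_fun do rewrite raddfD; exact: is_deriveD.
Qed.

Lemma Re_mul l m : Re (l * m) = Re l * Re m - Im l * Im m.
Proof. by case: l m => [a b] [? ?]. Qed.

Lemma Re_opp l : Re (- l) = - Re l. Proof. by case: l. Qed.

Lemma Im_opp l : Im (- l) = - Im l. Proof. by case: l. Qed.

Lemma Im_mul l m : Im (l * m) = Re l * Im m + Im l * Re m.
Proof. by case: l m => [a b] [? ?]. Qed.

Lemma is_cderiveM t c d l m : is_cderive t c l -> is_cderive t d m ->
  is_cderive t (fun s => c s * d s) (l * d t + c t * m).
Proof.
move=> [lr li] [mr mi]; split; rewrite raddfD /=.
  under eq_fun do rewrite Re_mul.
  apply: (is_derive_eq (is_deriveB (is_deriveM lr mr) (is_deriveM li mi))).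
  by rewrite !Re_mul /GRing.scale /=; ring.
under eq_fun do rewrite Im_mul.
apply: (is_derive_eq (is_deriveD (is_deriveM lr mi) (is_deriveM li mr))).
by rewrite !Im_mul /GRing.scale /=; ring.
Qed.

(** Serves with [a = 1] to move the base point along a line and with [b = 0] to rescale a
    direction. *)
Lemma is_cderive_affine t c l (a b : R) : is_cderive (a * t + b) c l ->
  is_cderive t (fun s => c (a * s + b)) (a%:C * l).
Proof.
have da : is_derive t 1 (fun s : R => a * s + b) a.
  apply: (is_derive_eq (is_deriveD (is_deriveZ a (is_derive_id t 1))
    (is_derive_cst b t 1))).
  by rewrite addr0 /GRing.scale /= mulr1.
move=> [lr li]; split.
  apply: (is_derive_eq (@is_derive1_comp _ (fun s => Re (c s))
    (fun s : R => a * s + b) t _ _ lr da)).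
  by rewrite Re_mul /= mul0r subr0 mulrC.
apply: (is_derive_eq (@is_derive1_comp _ (fun s => Im (c s))
  (fun s : R => a * s + b) t _ _ li da)).
by rewrite Im_mul /= mul0r addr0 mulrC.
Qed.

Lemma is_cderive_lin t k : is_cderive t (fun s => s%:C * k) k.
Proof.
split.
  under eq_fun do rewrite Re_mul /= mul0r subr0 mulrC.
  apply: (is_derive_eq (is_deriveZ (Re k) (is_derive_id t 1))).
  by rewrite /GRing.scale /= mulr1.
under eq_fun do rewrite Im_mul /= mul0r addr0 mulrC.
apply: (is_derive_eq (is_deriveZ (Im k) (is_derive_id t 1))).
by rewrite /GRing.scale /= mulr1.
Qed.

Lemma is_derive_inv (f : R -> R) t (a : R) : f t != 0 -> is_derive t 1 f a ->
  is_derive t 1 (fun s => (f s)^-1) (- (f t ^- 2 * a)).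
Proof.
move=> f0 [fd <-]; apply: DeriveDef; first exact: derivableV.
by rewrite deriveV // scaleNr.
Qed.

Lemma is_cderiveV t c l : c t != 0 -> is_cderive t c l ->
  is_cderive t (fun s => (c s)^-1) (- ((c t)^-1 ^+ 2 * l)).
Proof.
move=> c0 [lr li].
(* The squared modulus: the inverse is the conjugate divided by [n], which reduces the claim to real
   quotients. *)
pose n s := Re (c s) * Re (c s) + Im (c s) * Im (c s).
have n0 : n t != 0.
  apply: contra c0; rewrite /n -!expr2 paddr_eq0 ?sqr_ge0 // !sqrf_eq0.
  by rewrite eq_complex.
have dn : is_derive t 1 n (2 * (Re (c t) * Re l + Im (c t) * Im l)).
  apply: (is_derive_eq (is_deriveD (is_deriveM lr lr) (is_deriveM li li))).
  by rewrite /GRing.scale /=; ring.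
have invE z : z^-1 = (Re z / (Re z * Re z + Im z * Im z)) -i*
    (Im z / (Re z * Re z + Im z * Im z)) by case: z => a b; rewrite -!expr2.
have dV := is_derive_inv n0 dn.
split.
  under eq_fun do rewrite invE /=.
  apply: (is_derive_eq (is_deriveM lr dV)).
 rewrite Re_opp !(expr2, Re_mul, Im_mul) !invE /=.
  rewrite /GRing.scale /=; move: n0; rewrite /n.
  set u := Re (c t); set v := Im (c t) => n0.
  by field.
under eq_fun do rewrite invE /=.
apply: (is_derive_eq (is_deriveN (is_deriveM li dV))).
rewrite Im_opp !(expr2, Re_mul, Im_mul) !invE /=.
rewrite /GRing.scale /=; move: n0; rewrite /n.
set u := Re (c t); set v := Im (c t) => n0.
by field.
Qed.

End curves.

(** * Smooth functions *)

Section directional_derivatives.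
Context {R : realType} {V : normedModType R[i]}.
Local Notation Re := (@complex.Re R).
Local Notation Im := (@complex.Im R).
Implicit Types (f g : V -> R[i]) (v w x : V) (U : set V).

Definition is_rderive v f x l := is_cderive 0 (fun t => f (x + t%:C *: v)) l.

Lemma real_deriveP v f x : real_derivable v f x ->
  is_rderive v f x (real_derive v f x).
Proof.
move=> [fr fi]; split; rewrite /= derive1E.
  exact: derivableP fr.
exact: derivableP fi.
Qed.

Lemma is_rderive_derivable v f x l : is_rderive v f x l -> real_derivable v f x.
Proof. by move=> [[fr _] [fi _]]; split; [exact: fr|exact: fi]. Qed.

Lemma is_rderiveE v f x l : is_rderive v f x l -> real_derive v f x = l.
Proof.
move=> fl; apply: is_cderive_unique (fl).
exact/real_deriveP/is_rderive_derivable/fl.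
Qed.

Lemma line_continuous x v : continuous (fun t : R => x + t%:C *: v).
Proof.
move=> t; apply: cvgD; first exact: cvg_cst.
by apply: cvgZr_tmp; exact: real_complex_continuous.
Qed.

Lemma line_near U x v (t : R) : open U -> U (x + t%:C *: v) ->
  \forall s \near t, U (x + s%:C *: v).
Proof.
move=> oU Ux.
exact: (@line_continuous x v t U (open_nbhs_nbhs (conj oU Ux))).
Qed.

(** The curve started at [x + t%:C *: v] is the curve started at [x] with its parameter shifted by
    [t]. *)
Lemma is_rderive_line v f x (t : R) l : is_rderive v f (x + t%:C *: v) l ->
  is_cderive t (fun s => f (x + s%:C *: v)) l.
Proof.
rewrite /is_rderive -{1}(subrr t) -{1}[t]mul1r => /is_cderive_affine.
rewrite mul1r; congr is_cderive; apply/funext => s.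
by rewrite mul1r -addrA -scalerDl -rmorphD addrCA subrr addr0.
Qed.

Lemma is_rderive_eq_on U v f g x l : open U -> U x ->
  (forall y, U y -> f y = g y) -> is_rderive v f x l -> is_rderive v g x l.
Proof.
move=> oU Ux fg; apply: is_cderive_near.
have : U (x + 0%:C *: v) by rewrite scale0r addr0.
by move=> /(line_near oU); apply: filterS => t /fg.
Qed.

(** Curves that agree near 0 have the same difference quotients there, so the derivatives agree even
    when they are default values. *)
Lemma real_derive_eq_on U v f g x : open U -> U x ->
  (forall y, U y -> f y = g y) -> real_derive v f x = real_derive v g x.
Proof.
move=> oU Ux fg.
have : \forall t \near 0, U (x + t%:C *: v).
  by apply: line_near => //; rewrite scale0r addr0.
move=> Un; rewrite /real_derive !derive1E; congr (_ +i* _).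
  by apply: near_eq_derive; apply: filterS Un => t /fg ->.
by apply: near_eq_derive; apply: filterS Un => t /fg ->.
Qed.

Lemma is_rderive_cst v x k : is_rderive v (fun=> k) x 0.
Proof. exact: is_cderive_cst. Qed.

Lemma is_rderiveD v f g x l m : is_rderive v f x l -> is_rderive v g x m ->
  is_rderive v (fun y => f y + g y) x (l + m).
Proof. exact: is_cderiveD. Qed.

Lemma is_rderiveM v f g x l m : is_rderive v f x l -> is_rderive v g x m ->
  is_rderive v (fun y => f y * g y) x (l * g x + f x * m).
Proof.
move=> fl gm; have := is_cderiveM fl gm.
by rewrite scale0r addr0.
Qed.

Lemma is_rderiveV v f x l : f x != 0 -> is_rderive v f x l ->
  is_rderive v (fun y => (f y)^-1) x (- ((f x)^-1 ^+ 2 * l)).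
Proof.
move=> fx fl; have xE : x + (0 : R)%:C *: v = x by rewrite scale0r addr0.
by have := @is_cderiveV _ 0 _ _ _ fl; rewrite xE; apply.
Qed.

End directional_derivatives.

Section smooth_functions.
Context {R : realType} {V : normedModType R[i]}.
Implicit Types (f g : V -> R[i]) (v w x : V) (U : set V).

Lemma smooth_continuous U f x : smooth_on U f -> U x -> {for x, continuous f}.
Proof. by move=> sf Ux; case: (sf [::] x Ux). Qed.

Lemma smooth_derivable U f x v : smooth_on U f -> U x -> real_derivable v f x.
Proof. by move=> sf Ux; case: (sf [::] x Ux). Qed.

Lemma smooth_is_rderive U f x v : smooth_on U f -> U x ->
  is_rderive v f x (real_derive v f x).
Proof. by move=> sf Ux; apply/real_deriveP/smooth_derivable/Ux. Qed.

Lemma smooth_real_derive U f v : smooth_on U f -> smooth_on U (real_derive v f).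
Proof.
by move=> sf ds x Ux; have := sf (rcons ds v) x Ux; rewrite foldr_rcons.
Qed.

Lemma smooth_cst U k : smooth_on U (fun=> k : R[i]).
Proof.
suff E ds : exists k',
    foldr real_derive (fun=> k) ds = (fun=> k') :> (V -> R[i]).
  move=> ds x Ux; have [k' ->] := E ds; split; first exact: cvg_cst.
  by move=> v; exact: is_rderive_derivable (is_rderive_cst _ _ _).
elim: ds => [|v ds [k' /= ->]]; first by exists k.
by exists 0; apply/funext => x; apply: is_rderiveE; exact: is_rderive_cst.
Qed.

(* The closure of the smooth functions under the operations below is stable
   under directional derivation, hence consists of smooth functions. *)
Inductive smooth_closure U : (V -> R[i]) -> Prop :=
| SmoothBase f of smooth_on U f : smooth_closure U f
| SmoothExt f g of smooth_closure U f & (forall x, U x -> f x = g x) :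
    smooth_closure U g
| SmoothAdd f g of smooth_closure U f & smooth_closure U g :
    smooth_closure U (fun x => f x + g x)
| SmoothMul f g of smooth_closure U f & smooth_closure U g :
    smooth_closure U (fun x => f x * g x)
| SmoothInv f of smooth_closure U f & (forall x, U x -> f x != 0) :
    smooth_closure U (fun x => (f x)^-1).

(** Induction on the closure. The rules for sums, products and inverses give the derivative only on
    [U], whence [SmoothExt]; those for products and inverses also involve the undifferentiated
    functions, which lie in the closure too. *)
Lemma smooth_closure_derive U f : open U -> smooth_closure U f ->
  (forall x, U x ->
    {for x, continuous f} /\ forall v, real_derivable v f x) /\
  forall v, smooth_closure U (real_derive v f).
Proof.
move=> oU; elim=> {f} [f sf|f g _ [f1 f2] fg|f g cf [f1 f2] cg [g1 g2]|
  f g cf [f1 f2] cg [g1 g2]|f cf [f1 f2] f0].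
- split; first by move=> x Ux; exact: (sf [::]).
  by move=> v; apply/SmoothBase/smooth_real_derive.
- split; last first.
    move=> v; apply: SmoothExt (f2 v) _ => x Ux; exact: real_derive_eq_on fg.
  move=> x Ux; have [fc fd] := f1 x Ux; split; last first.
    move=> v; have := is_rderive_eq_on oU Ux fg (real_deriveP (fd v)).
    exact: is_rderive_derivable.
  rewrite /prop_for /continuous_at -fg //; apply: cvg_trans fc.
  apply: near_eq_cvg; near=> y; apply: fg; near: y.
  exact: open_nbhs_nbhs.
- have E x v : U x -> is_rderive v (fun y => f y + g y) x
      (real_derive v f x + real_derive v g x).
    move=> Ux; have [[_ fd] [_ gd]] := (f1 x Ux, g1 x Ux).
    exact: is_rderiveD (real_deriveP (fd v)) (real_deriveP (gd v)).
  split=> [x Ux|v]; last first.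
    apply: SmoothExt (SmoothAdd (f2 v) (g2 v)) _ => x Ux.
    exact/esym/is_rderiveE/E.
  have [[fc _] [gc _]] := (f1 x Ux, g1 x Ux).
  split; first exact: (@continuousD _ _ _ _ _ _ fc gc).
  by move=> v; apply: is_rderive_derivable (E x v Ux).
- have E x v : U x -> is_rderive v (fun y => f y * g y) x
      (real_derive v f x * g x + f x * real_derive v g x).
    move=> Ux; have [[_ fd] [_ gd]] := (f1 x Ux, g1 x Ux).
    exact: is_rderiveM (real_deriveP (fd v)) (real_deriveP (gd v)).
  split=> [x Ux|v]; last first.
    apply: SmoothExt (SmoothAdd (SmoothMul (f2 v) cg) (SmoothMul cf (g2 v))) _.
    by move=> x Ux; exact/esym/is_rderiveE/E.
  have [[fc _] [gc _]] := (f1 x Ux, g1 x Ux).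
  split; first exact: (@continuousM _ _ _ _ _ fc gc).
  by move=> v; apply: is_rderive_derivable (E x v Ux).
- have E x v : U x -> is_rderive v (fun y => (f y)^-1) x
      (- ((f x)^-1 ^+ 2 * real_derive v f x)).
    move=> Ux; have [_ fd] := f1 x Ux.
    exact: is_rderiveV (f0 x Ux) (real_deriveP (fd v)).
  have ci := SmoothInv cf f0.
  split=> [x Ux|v]; last first.
    (* The minus sign of the derivative of the inverse enters as the constant factor -1. *)
    apply: (SmoothExt (SmoothMul (SmoothMul
      (SmoothBase (smooth_cst (U := U) (-1))) (SmoothMul ci ci))
      (f2 v))) => x Ux.
    by rewrite (is_rderiveE (E x v Ux)) mulN1r mulNr expr2.
  have [fc _] := f1 x Ux.
  split; first exact: (@cvgV _ _ _ _ _ _ (f0 x Ux) fc).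
  by move=> v; apply: is_rderive_derivable (E x v Ux).
Unshelve. all: by end_near. Qed.

Lemma smooth_closureP U f : open U -> smooth_closure U f -> smooth_on U f.
Proof.
move=> oU cf ds.
have : smooth_closure U (foldr real_derive f ds).
  by elim: ds => //= v ds /(smooth_closure_derive oU)[_]; apply.
by move=> /(smooth_closure_derive oU)[+ _] x Ux; apply.
Qed.

End smooth_functions.

(** * Operations preserving smoothness *)

Section smooth_operations.
Context {R : realType} {V : normedModType R[i]} (U : set V) (oU : open U).
Implicit Types (f g : V -> R[i]) (v w x : V).

Lemma smooth_ext f g : (forall x, U x -> f x = g x) -> smooth_on U f ->
  smooth_on U g.
Proof.
by move=> fg sf; apply: smooth_closureP => //;
  exact: SmoothExt (SmoothBase sf) fg.
Qed.

Lemma smoothD f g : smooth_on U f -> smooth_on U g ->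
  smooth_on U (fun x => f x + g x).
Proof.
by move=> sf sg; apply: smooth_closureP => //;
  apply: SmoothAdd; exact: SmoothBase.
Qed.

Lemma smoothM f g : smooth_on U f -> smooth_on U g ->
  smooth_on U (fun x => f x * g x).
Proof.
by move=> sf sg; apply: smooth_closureP => //;
  apply: SmoothMul; exact: SmoothBase.
Qed.

Lemma smoothZ k f : smooth_on U f -> smooth_on U (fun x => k * f x).
Proof. by move=> sf; exact: (smoothM (smooth_cst (U := U) k) sf). Qed.

Lemma smoothV f : (forall x, U x -> f x != 0) -> smooth_on U f ->
  smooth_on U (fun x => (f x)^-1).
Proof.
by move=> f0 sf; apply: smooth_closureP => //;
  exact: SmoothInv (SmoothBase sf) f0.
Qed.

Lemma smooth_sum (I : Type) (r : seq I) (P : pred I) (F : I -> V -> R[i]) :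
  (forall i, P i -> smooth_on U (F i)) ->
  smooth_on U (fun x => \sum_(i <- r | P i) F i x).
Proof.
move=> sF; elim: r => [|i r IH].
  by under eq_fun do rewrite big_nil; exact: smooth_cst.
under eq_fun do rewrite big_cons.
case Pi: (P i); last exact: IH.
exact: (smoothD (sF i Pi) IH).
Qed.

Lemma smooth_prod (I : Type) (r : seq I) (P : pred I) (F : I -> V -> R[i]) :
  (forall i, P i -> smooth_on U (F i)) ->
  smooth_on U (fun x => \prod_(i <- r | P i) F i x).
Proof.
move=> sF; elim: r => [|i r IH].
  by under eq_fun do rewrite big_nil; exact: smooth_cst.
under eq_fun do rewrite big_cons.
case Pi: (P i); last exact: IH.
exact: (smoothM (sF i Pi) IH).
Qed.

Lemma smooth_det (n : nat) (A : V -> 'M[R[i]]_n) :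
  (forall i j, smooth_on U (fun x => A x i j)) ->
  smooth_on U (fun x => \det (A x)).
Proof.
move=> sA; apply: smooth_sum => s _; apply: smoothM; first exact: smooth_cst.
by apply: smooth_prod => i _; exact: sA.
Qed.

Lemma smooth_adj (n : nat) (A : V -> 'M[R[i]]_n) i j :
  (forall i j, smooth_on U (fun x => A x i j)) ->
  smooth_on U (fun x => (\adj (A x)) i j).
Proof.
move=> sA; under eq_fun do rewrite mxE.
apply: smoothM; first exact: smooth_cst.
by apply: smooth_det => k l; under eq_fun do rewrite !mxE; exact: sA.
Qed.

(** Cramer's rule: cofactors over the determinant, all polynomial in the entries. Invertibility on
    [U] makes [invmx] obey this formula and keeps the determinant away from 0. *)
Lemma smooth_invmx (n : nat) (A : V -> 'M[R[i]]_n) i j :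
  (forall x, U x -> A x \in unitmx) ->
  (forall i j, smooth_on U (fun x => A x i j)) ->
  smooth_on U (fun x => (invmx (A x)) i j).
Proof.
move=> uA sA.
apply: (@smooth_ext (fun x => (\det (A x))^-1 * (\adj (A x)) i j)).
  by move=> x Ux; rewrite /invmx uA // [RHS]mxE.
apply: smoothM (smooth_adj _ _ sA); apply: smoothV (smooth_det sA) => x Ux.
by rewrite -unitfE -unitmxE uA.
Qed.

Lemma smooth_wirtinger f v : smooth_on U f -> smooth_on U (wirtinger v f).
Proof.
move=> sf; apply: (@smoothM (fun x => real_derive v f x +
  - ('i * real_derive ('i *: v) f x)) (fun=> 2^-1)); last exact: smooth_cst.
apply: smoothD; first exact: smooth_real_derive.
apply: (@smooth_ext (fun x => - 'i * real_derive ('i *: v) f x)).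
  by move=> x _; rewrite mulNr.
apply: smoothM; first exact: smooth_cst.
exact: smooth_real_derive.
Qed.

Lemma smooth_wirtinger_bar f v :
  smooth_on U f -> smooth_on U (wirtinger_bar v f).
Proof.
move=> sf; apply: (@smoothM (fun x => real_derive v f x +
  'i * real_derive ('i *: v) f x) (fun=> 2^-1)); last exact: smooth_cst.
apply: smoothD; first exact: smooth_real_derive.
apply: smoothM; first exact: smooth_cst.
exact: smooth_real_derive.
Qed.

End smooth_operations.

(** * Symmetry of derivatives and Wirtinger derivatives *)

Section direction_calculus.
Context {R : realType} {V : normedModType R[i]} (U : set V) (oU : open U).
Local Notation Re := (@complex.Re R).
Local Notation Im := (@complex.Im R).
Implicit Types (f g : V -> R[i]) (u v w x : V).

Lemma complex_eq (k l : R[i]) : Re k = Re l -> Im k = Im l -> k = l.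
Proof. by case: k l => [? ?] [? ?] /= -> ->. Qed.

(** Pulls functions on [V] back to two real variables, where the lemmas on mixed and diagonal
    derivatives apply. *)
Definition plane x u v (s t : R) := x + s%:C *: u + t%:C *: v.

Section plane.
Context (x u v : V).
Local Notation p := (plane x u v).

Lemma plane00 : p 0 0 = x.
Proof. by rewrite /plane !scale0r !addr0. Qed.

Lemma plane_continuous : continuous (fun st : R * R => p st.1 st.2).
Proof.
move=> st; apply: cvgD; last first.
  apply: cvgZr_tmp.
  by apply: (@continuous_comp _ _ _ snd (fun r : R => r%:C));
    [exact: cvg_snd|exact: real_complex_continuous].
apply: cvgD; first exact: cvg_cst.
apply: cvgZr_tmp.
by apply: (@continuous_comp _ _ _ fst (fun r : R => r%:C));
  [exact: cvg_fst|exact: real_complex_continuous].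
Qed.

Lemma plane_derive1 g s t : smooth_on U g -> U (p s t) ->
  is_cderive s (fun s => g (p s t)) (real_derive u g (p s t)).
Proof.
have pE s' : p s' t = (x + t%:C *: v) + s'%:C *: u by rewrite /plane addrAC.
move=> sg Up; under eq_fun do rewrite pE; rewrite pE.
by apply: is_rderive_line; apply: smooth_is_rderive (sg) _; rewrite -pE.
Qed.

Lemma plane_derive2 g s t : smooth_on U g -> U (p s t) ->
  is_cderive t (fun t => g (p s t)) (real_derive v g (p s t)).
Proof.
by move=> sg Up; apply: is_rderive_line; exact: smooth_is_rderive Up.
Qed.

Hypothesis Ux : U x.

Let p_box : exists2 e : R, 0 < e &
  forall s t, `|s| < e -> `|t| < e -> U (p s t).
Proof.
have /nbhs_ballP[e /= e0 eU] :
    nbhs ((0, 0) : R * R) (fun st => U (p st.1 st.2)).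
  apply: (@plane_continuous (0, 0) U); rewrite /= plane00.
  exact: open_nbhs_nbhs.
exists e => // s t se te; apply: (eU (s, t)).
by split; rewrite -ball_normE /= sub0r normrN.
Qed.

Let p_smooth g : smooth_on U g ->
  {for (0, 0), continuous (fun st : R * R => g (p st.1 st.2))}.
Proof.
move=> sg; apply: (@continuous_comp _ _ _ (fun st : R * R => p st.1 st.2) g).
  exact: plane_continuous.
by rewrite /= plane00; exact: smooth_continuous sg Ux.
Qed.

(** Schwarz's theorem for the real and imaginary parts of [f] on the plane through [x] spanned by
    [u] and [v]. *)
Lemma real_deriveC f : smooth_on U f ->
  real_derive u (real_derive v f) x = real_derive v (real_derive u f) x.
Proof.
move=> sf; have [e e0 eU] := p_box.
have su := smooth_real_derive u sf; have sv := smooth_real_derive v sf.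
have suv := smooth_real_derive u sv; have svu := smooth_real_derive v su.
have eRe := @mixed_partials _ (fun s t => Re (f (p s t)))
  (fun s t => Re (real_derive u f (p s t)))
  (fun s t => Re (real_derive v f (p s t)))
  (fun s t => Re (real_derive v (real_derive u f) (p s t)))
  (fun s t => Re (real_derive u (real_derive v f) (p s t))) e e0.
have eIm := @mixed_partials _ (fun s t => Im (f (p s t)))
  (fun s t => Im (real_derive u f (p s t)))
  (fun s t => Im (real_derive v f (p s t)))
  (fun s t => Im (real_derive v (real_derive u f) (p s t)))
  (fun s t => Im (real_derive u (real_derive v f) (p s t))) e e0.
apply: complex_eq.
  apply/esym; move: eRe; rewrite /= plane00; apply.
  - move=> s t se te; have Up := eU _ _ se te.
    have [h1 _] := plane_derive1 sf Up; have [h2 _] := plane_derive2 sf Up.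
    have [h3 _] := plane_derive2 su Up; have [h4 _] := plane_derive1 sv Up.
    split; [exact: h1|exact: h2|exact: h3|exact: h4].
  - exact: continuous_comp (p_smooth svu) (@Re_continuous R _).
  - exact: continuous_comp (p_smooth suv) (@Re_continuous R _).
apply/esym; move: eIm; rewrite /= plane00; apply.
- move=> s t se te; have Up := eU _ _ se te.
  have [_ h1] := plane_derive1 sf Up; have [_ h2] := plane_derive2 sf Up.
  have [_ h3] := plane_derive2 su Up; have [_ h4] := plane_derive1 sv Up.
    split; [exact: h1|exact: h2|exact: h3|exact: h4].
- exact: continuous_comp (p_smooth svu) (@Im_continuous R _).
- exact: continuous_comp (p_smooth suv) (@Im_continuous R _).
Qed.

(** The line in direction [u + v] is the diagonal of the plane, so [derive_diag] applies to both
    components. *)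
Lemma real_derive_addv f : smooth_on U f ->
  real_derive (u + v) f x = real_derive u f x + real_derive v f x.
Proof.
move=> sf; have [e e0 eU] := p_box.
have sv := smooth_real_derive v sf.
have Up0 : U (p 0 0) by rewrite plane00.
have [r1 i1] := plane_derive1 sf Up0.
apply: is_rderiveE; rewrite /is_rderive.
have -> : (fun t : R => f (x + t%:C *: (u + v))) = (fun t => f (p t t)).
  by apply/funext => t; rewrite /plane scalerDr addrA.
have eRe := @derive_diag _ (fun s t => Re (f (p s t)))
    (fun s t => Re (real_derive v f (p s t))) _ e e0 _ r1.
have eIm := @derive_diag _ (fun s t => Im (f (p s t)))
    (fun s t => Im (real_derive v f (p s t))) _ e e0 _ i1.
split; rewrite raddfD.
  move: eRe; rewrite /= plane00; apply.
    by move=> s t se te; case: (plane_derive2 sf (eU _ _ se te)).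
  exact: continuous_comp (p_smooth sv) (@Re_continuous R _).
move: eIm; rewrite /= plane00; apply.
  by move=> s t se te; case: (plane_derive2 sf (eU _ _ se te)).
exact: continuous_comp (p_smooth sv) (@Im_continuous R _).
Qed.

End plane.

Lemma real_derive_scalev f v x (a : R) : smooth_on U f -> U x ->
  real_derive (a%:C *: v) f x = a%:C * real_derive v f x.
Proof.
move=> sf Ux; apply: is_rderiveE; rewrite /is_rderive.
have -> : (fun t : R => f (x + t%:C *: (a%:C *: v))) =
    (fun t => f (x + (a * t + 0)%:C *: v)).
  by apply/funext => t; rewrite addr0 scalerA -rmorphM mulrC.
apply: (@is_cderive_affine _ 0 (fun t => f (x + t%:C *: v))).
by rewrite mulr0 addr0; exact: (smooth_is_rderive v sf Ux).
Qed.

Lemma i_mul_i : 'i * 'i = -1 :> R[i]. Proof. by rewrite -expr2 sqr_i. Qed.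

Lemma real_derive_complex_scalev f v x (c : R[i]) : smooth_on U f -> U x ->
  real_derive (c *: v) f x =
  (Re c)%:C * real_derive v f x + (Im c)%:C * real_derive ('i *: v) f x.
Proof.
move=> sf Ux; rewrite {1}[c]complexE scalerDl mulrC -scalerA.
by rewrite real_derive_addv // !real_derive_scalev.
Qed.

(** Here [D] and [E] stand for the derivatives along v and iv, p + iq for the scalar c and [h] for
    1/2; then pD + qE and -qD + pE are the derivatives along cv and icv. *)
Lemma wirtinger_algebra (p q D E h : R[i]) :
  (p * D + q * E - 'i * (- q * D + p * E)) * h =
    (p + 'i * q) * ((D - 'i * E) * h) /\
  (p * D + q * E + 'i * (- q * D + p * E)) * h =
    (p - 'i * q) * ((D + 'i * E) * h).
Proof.
have jj : 'i * 'i + 1 = 0 :> R[i] by rewrite i_mul_i addNr.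
(* With 'i abstracted, both identities become polynomial: the two sides differ by
   [(j * j + 1) * (q * E * h)]. *)
move: jj; generalize ('i : R[i]) => j jj.
split; apply/eqP; rewrite -subr_eq0; apply/eqP.
  by rewrite -[RHS](mul0r (q * E * h)) -jj; ring.
by rewrite -[RHS](mul0r (q * E * h)) -jj; ring.
Qed.

(** The factors [c] and [c^*] account for the degrees lost under [d_eta] and [d_etabar] in the
    homogeneity lemmas. *)
Lemma wirtinger_scalev f v x (c : R[i]) : smooth_on U f -> U x ->
  wirtinger (c *: v) f x = c * wirtinger v f x /\
  wirtinger_bar (c *: v) f x = c^* * wirtinger_bar v f x.
Proof.
move=> sf Ux; rewrite /wirtinger /wirtinger_bar scalerA.
rewrite (real_derive_complex_scalev _ c) //.
rewrite (real_derive_complex_scalev _ ('i * c)) //.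
rewrite ['i * c]mulrC ReiNIm ImiRe rmorphN /=.
have [-> ->] := wirtinger_algebra (Re c)%:C (Im c)%:C (real_derive v f x)
  (real_derive ('i *: v) f x) 2^-1.
rewrite -complexE; split => //; congr (_ * _).
by apply: complex_eq; case: (c) => a b /=; lra.
Qed.

Lemma wirtinger_addv f v w x : smooth_on U f -> U x ->
  wirtinger (v + w) f x = wirtinger v f x + wirtinger w f x /\
  wirtinger_bar (v + w) f x = wirtinger_bar v f x + wirtinger_bar w f x.
Proof.
move=> sf Ux; rewrite /wirtinger /wirtinger_bar scalerDr.
rewrite !real_derive_addv //.
move: (real_derive v f x) (real_derive w f x) => A B.
by move: (real_derive _ _ _) (real_derive _ _ _) => C D; split; ring.
Qed.

Lemma wirtinger_sumv f x (I : Type) (r : seq I) (c : I -> R[i]) (v : I -> V) :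
  smooth_on U f -> U x ->
  wirtinger (\sum_(i <- r) c i *: v i) f x =
    \sum_(i <- r) c i * wirtinger (v i) f x /\
  wirtinger_bar (\sum_(i <- r) c i *: v i) f x =
    \sum_(i <- r) (c i)^* * wirtinger_bar (v i) f x.
Proof.
move=> sf Ux; elim: r => [|k r [IH1 IH2]].
  rewrite !big_nil -(scale0r (0 : V)).
  have [-> ->] := wirtinger_scalev 0 0 sf Ux.
  by rewrite conjC0 !mul0r.
rewrite !big_cons.
have [-> ->] := wirtinger_addv (c k *: v k) (\sum_(i <- r) c i *: v i) sf Ux.
by have [-> ->] := wirtinger_scalev (v k) (c k) sf Ux; rewrite IH1 IH2.
Qed.

Lemma real_deriveD f g v x : smooth_on U f -> smooth_on U g -> U x ->
  real_derive v (fun y => f y + g y) x = real_derive v f x + real_derive v g x.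
Proof.
by move=> sf sg Ux; apply/is_rderiveE/is_rderiveD; exact: smooth_is_rderive Ux.
Qed.

Lemma real_deriveZ f v x (k : R[i]) : smooth_on U f -> U x ->
  real_derive v (fun y => k * f y) x = k * real_derive v f x.
Proof.
move=> sf Ux; apply: is_rderiveE.
have := is_rderiveM (is_rderive_cst v x k) (smooth_is_rderive v sf Ux).
by rewrite mul0r add0r.
Qed.

(** Wirtinger derivatives are combinations of real derivatives with constant coefficients, and real
    derivatives commute. *)
Lemma real_derive_wirtinger f u v x : smooth_on U f -> U x ->
  real_derive u (wirtinger v f) x = wirtinger v (real_derive u f) x /\
  real_derive u (wirtinger_bar v f) x = wirtinger_bar v (real_derive u f) x.
Proof.
move=> sf Ux.
have s1 := smooth_real_derive v sf; have s2 := smooth_real_derive ('i *: v) sf.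
have -> : wirtinger v f = (fun y => 2^-1 * real_derive v f y +
    (- 'i / 2) * real_derive ('i *: v) f y).
  by apply/funext => y; rewrite /wirtinger; ring.
have -> : wirtinger_bar v f = (fun y => 2^-1 * real_derive v f y +
    ('i / 2) * real_derive ('i *: v) f y).
  by apply/funext => y; rewrite /wirtinger_bar; ring.
have s1' := smoothZ oU 2^-1 s1; have s2' := smoothZ oU (- 'i / 2) s2.
have s2'' := smoothZ oU ('i / 2) s2.
rewrite (real_deriveD _ s1' s2') // (real_deriveD _ s1' s2'') //.
rewrite !(real_deriveZ _ _ s1) // !(real_deriveZ _ _ s2) //.
rewrite !(real_deriveC u _ Ux sf) /wirtinger /wirtinger_bar.
by move: (real_derive _ _ _) (real_derive _ _ _) => A B; split; ring.
Qed.

Lemma wirtingerC f u v x : smooth_on U f -> U x ->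
  wirtinger_bar u (wirtinger v f) x = wirtinger v (wirtinger_bar u f) x.
Proof.
move=> sf Ux; rewrite {1}/wirtinger_bar.
rewrite !(real_derive_wirtinger _ v sf Ux).1 /wirtinger.
rewrite !(real_derive_wirtinger _ u sf Ux).2 /wirtinger_bar.
rewrite !(real_deriveC _ ('i *: v) Ux sf) !(real_deriveC _ v Ux sf).
have E (A B C D j : R[i]) : ((A - j * B) / 2 + j * ((C - j * D) / 2)) / 2 =
    ((A + j * C) / 2 - j * ((B + j * D) / 2)) / 2 by ring.
exact: E.
Qed.

End direction_calculus.

(** * The maximum principle and entire functions *)

Section maximum_principle.
Context {R : realType}.

Lemma is_derive_translate (f : R -> R) (c t l : R) :
  is_derive (c + t) 1 f l -> is_derive t 1 (fun s => f (c + s)) l.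
Proof.
move=> fl; have dc : is_derive t 1 (fun s : R => c + s) 1.
  apply: (is_derive_eq (is_deriveD (is_derive_cst c t 1) (is_derive_id t 1))).
  by rewrite add0r.
apply: (is_derive_eq (@is_derive1_comp _ f (fun s : R => c + s) t _ _ fl dc)).
by rewrite mulr1.
Qed.

(** At the maximum [g1] vanishes. Were [l] positive, [g1] would be positive just to the right of 0
    and [g] would exceed [g 0] there. *)
Lemma second_derivative_max (g g1 : R -> R) (l e : R) : 0 < e ->
  (forall x : R, `|x| < e -> is_derive x 1 g (g1 x)) ->
  is_derive (0 : R) 1 g1 l -> (forall x, `|x| < e -> g x <= g 0) -> l <= 0.
Proof.
move=> e0 dg /is_derive0P dg1 gmax; rewrite leNgt; apply/negP => l0.
have inE (x : R) : x \in `](- e), e[ -> `|x| < e.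
  by rewrite in_itv /= ltr_norml.
have g10 : g1 0 = 0.
  have : is_derive (0 : R) 1 g 0.
    apply: (@derive1_at_max _ g (- e) e 0).
    - by rewrite ge0_cp // ltW.
    - by move=> t /inE /dg [].
    - by rewrite in_itv /= oppr_lt0 e0.
    - by move=> t /inE /gmax.
  have : is_derive (0 : R) 1 g (g1 0) by apply: dg; rewrite normr0.
  by move=> [_ e1] [_ e2]; rewrite -e1 e2.
(* Tolerance [l] itself suffices: a quotient closer than [l] to [l] is positive. *)
have [d d0 dl] := dg1 l l0.
pose h := Num.min e d / 2.
have m0 : 0 < Num.min e d by rewrite lt_min e0.
have h0 : 0 < h by rewrite divr_gt0.
have : h < Num.min e d by rewrite /h; lra.
rewrite lt_min => /andP[he hd].
have [||c] := @MVT _ g g1 0 h h0.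
- move=> x; rewrite in_itv /= => /andP[x0 xh]; apply: dg.
  by rewrite gtr0_norm // (lt_trans xh).
- apply: derivable_within_continuous => x; rewrite in_itv /= => /andP[x0 xh].
  have : is_derive x 1 g (g1 x).
    by apply: dg; rewrite ger0_norm // (le_lt_trans xh).
  by case.
rewrite in_itv /= subr0 => /andP[c0 ch] E.
have g1c : 0 < g1 c.
  have := dl c (lt0r_neq0 c0).
  rewrite gtr0_norm // (lt_trans ch) // => /(_ isT).
  rewrite g10 subr0 ltr_norml => /andP[+ _]; rewrite ltrBrDr addNr => gc.
  by have := mulr_gt0 gc c0; rewrite divfK // lt0r_neq0.
have : 0 < g h - g 0 by rewrite E mulr_gt0.
by rewrite subr_gt0 ltNge gmax // gtr0_norm.
Qed.

(** Maximum principle on a large square. If [u 0 0] were positive, a perturbation of [u] would have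
    an interior maximum, where both pure second derivatives are at most 0, although their sum is
    positive. *)
Lemma harmonic_le0 (u u1 u2 u11 u22 : R -> R -> R) :
  (forall s t : R,
   [/\ is_derive s 1 (u^~ t) (u1 s t), is_derive t 1 (u s) (u2 s t),
     is_derive s 1 (u1^~ t) (u11 s t) & is_derive t 1 (u2 s) (u22 s t)]) ->
  (forall s t, u11 s t + u22 s t = 0) ->
  continuous (fun p => u p.1 p.2) ->
  (forall e, 0 < e -> exists r, forall s t, r <= `|s| \/ r <= `|t| ->
    u s t <= e) ->
  u 0 0 <= 0.
Proof.
move=> du lap cu u_oo; rewrite leNgt; apply/negP => m0.
set m := u 0 0 in m0.
have [r0 ur0] : exists r, forall s t, r <= `|s| \/ r <= `|t| -> u s t <= m / 4.
  by apply: u_oo; rewrite divr_gt0.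
pose r := Num.max r0 1.
have r_gt0 : 0 < r by rewrite lt_max ltr01 orbT.
have ur s t : r <= `|s| \/ r <= `|t| -> u s t <= m / 4.
  by case=> rs; apply: ur0; [left|right]; apply: le_trans rs;
    rewrite le_max lexx.
(* On the square of half-side r the perturbation is at most 2 e r^2 = m/2; added to the bound m/4
   for [u] on the boundary, it stays below m. *)
pose e := m / (4 * r ^+ 2).
have e0 : 0 < e by rewrite divr_gt0 // mulr_gt0 // exprn_gt0.
have er : 4 * (e * r ^+ 2) = m.
  by rewrite /e; field; rewrite gt_eqF.
(* The constant e keeps v below v 0 0 on the boundary of Q, so that v has an
   interior maximum, although its Laplacian is 4 e > 0. *)
pose v s t := u s t + e * (s ^+ 2 + t ^+ 2).
pose Q := `[- r, r]%classic `*` `[- r, r]%classic : set (R * R).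
have inQ s t : Q (s, t) -> `|s| <= r /\ `|t| <= r.
  by rewrite /Q /= !in_itv /= !ler_norml.
have Q00 : Q (0, 0).
  by split; rewrite /= in_itv /= oppr_le0 ltW.
have [|||c] := @compact_EVT_max _ R (fun p => v p.1 p.2) Q _ _ _.
- by exists (0, 0).
- by apply: compact_setX; exact: segment_compact.
- apply: continuous_subspaceT => p; apply: cvgD; first exact: cu.
  apply: cvgM; first exact: cvg_cst.
  by apply: cvgD; rewrite !expr2; apply: cvgM;
    (exact: cvg_fst || exact: cvg_snd).
case: c => a b; rewrite inE => Qab vmax.
have vm : m <= v a b.
  have := vmax (0, 0); rewrite inE => /(_ Q00) /=.
  by rewrite /v expr0n addr0 mulr0 addr0.
have [ar br] := inQ _ _ Qab.
have sq (x : R) : `|x| <= r -> x ^+ 2 <= r ^+ 2.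
  move=> xr; rewrite -real_normK ?num_real //.
  by rewrite ler_pXn2r // nnegrE ltW.
have out : ~ (r <= `|a| \/ r <= `|b|).
  move=> /ur uab; have := lerD (sq _ ar) (sq _ br).
  move=> /(ler_wpM2l (ltW e0)); move: vm; rewrite /v mulrDr; lra.
have {}ar : `|a| < r by rewrite ltNge; apply/negP => ?; apply: out; left.
have {}br : `|b| < r by rewrite ltNge; apply/negP => ?; apply: out; right.
have dsq (c x k : R) : is_derive x 1 (fun y => e * ((c + y) ^+ 2 + k))
    (e * (2 * (c + x))).
  apply: (@is_derive_translate (fun z => e * (z ^+ 2 + k))); set y := c + x.
  under eq_fun do rewrite expr2.
  have did := is_derive_id y 1.
  apply: (is_derive_eq (is_deriveZ e
    (is_deriveD (is_deriveM did did) (is_derive_cst k y 1)))).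
  by rewrite /GRing.scale /=; ring.
have dlin (c x : R) : is_derive x 1 (fun y => e * (2 * (c + y))) (e * 2).
  apply: (@is_derive_translate (fun z => e * (2 * z))).
  apply: (is_derive_eq (is_deriveZ e (is_deriveZ 2 (is_derive_id (c + x) 1)))).
  by rewrite /GRing.scale /=; ring.
have near_in (c x : R) : `|x| < r - `|c| -> `|c + x| <= r.
  by move=> xc; apply: le_trans (ler_normD _ _) _; lra.
have Qin s t : `|s| <= r -> `|t| <= r -> (s, t) \in Q.
  by move=> sr tr; rewrite inE /Q /= !in_itv /= -!ler_norml.
(* The second derivative test along each axis through the maximum point; increments below [r - |a|],
   respectively [r - |b|], do not leave [Q]. *)
have l1 : u11 a b + e * 2 <= 0.
  apply: (@second_derivative_max (fun x => v (a + x) b)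
    (fun x => u1 (a + x) b + e * (2 * (a + x))) _ (r - `|a|)).
  - by rewrite subr_gt0.
  - move=> x _; have [/(@is_derive_translate (u^~ b)) h _ _ _] := du (a + x) b.
    exact: is_deriveD h (dsq a x (b ^+ 2)).
  - have h : is_derive (0 : R) 1 (fun x => u1 (a + x) b) (u11 a b).
      by apply: (@is_derive_translate (u1^~ b)); rewrite addr0; case: (du a b).
    exact: is_deriveD h (dlin a 0).
  - move=> x xr; rewrite addr0; apply: (vmax (a + x, b)).
    by apply: Qin; [exact: near_in|exact: ltW].
have l2 : u22 a b + e * 2 <= 0.
  apply: (@second_derivative_max (fun x => v a (b + x))
    (fun x => u2 a (b + x) + e * (2 * (b + x))) _ (r - `|b|)).
  - by rewrite subr_gt0.
  - move=> x _; have [_ /(@is_derive_translate (u a)) h _ _] := du a (b + x).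
    under eq_fun do rewrite /v [X in e * X]addrC.
    exact: is_deriveD h (dsq b x (a ^+ 2)).
  - have h : is_derive (0 : R) 1 (fun x => u2 a (b + x)) (u22 a b).
      by apply: (@is_derive_translate (u2 a)); rewrite addr0; case: (du a b).
    exact: is_deriveD h (dlin b 0).
  - move=> x xr; rewrite addr0; apply: (vmax (a, b + x)).
    by apply: Qin; [exact: ltW|exact: near_in].
by have := lap a b; lra.
Qed.

End maximum_principle.

Section entire_functions.
Context {R : realType} {V : normedModType R[i]} (U : set V) (oU : open U).
Local Notation Re := (@complex.Re R).
Local Notation Im := (@complex.Im R).

(** The Cauchy-Riemann equation turns a derivative along v into -i times the one along iv. Using it
    twice, with the two derivatives exchanged in between, produces the factor -1. *)
Lemma laplace_eq0 (f : V -> R[i]) v x : smooth_on U f ->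
  (forall y, U y -> wirtinger_bar v f y = 0) -> U x ->
  real_derive v (real_derive v f) x +
  real_derive ('i *: v) (real_derive ('i *: v) f) x = 0.
Proof.
move=> sf holo Ux.
have CR y : U y -> real_derive v f y = - 'i * real_derive ('i *: v) f y.
  move=> /holo /eqP; rewrite mulf_eq0 invr_eq0 pnatr_eq0 orbF => /eqP h.
  by rewrite mulNr; apply/eqP; rewrite -addr_eq0 h.
have sv := smooth_real_derive ('i *: v) sf.
rewrite (real_derive_eq_on v oU Ux CR) (real_deriveZ _ _ sv Ux).
rewrite (real_deriveC oU _ _ Ux sf) (real_derive_eq_on _ oU Ux CR).
rewrite (real_deriveZ _ _ sv Ux) mulrA mulrNN i_mul_i mulN1r addNr //.
Qed.

(** A form of Liouville's theorem: an entire function on a complex line with a limit at infinity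
    takes that limit as its value. *)
Lemma entire_limit (f : V -> R[i]) x v l : smooth_on U f ->
  (forall w : R[i], U (x + w *: v)) ->
  (forall y, U y -> wirtinger_bar v f y = 0) ->
  (forall e : R, 0 < e -> exists r : R, forall w : R[i], r%:C <= `|w| ->
    `|f (x + w *: v) - l| <= e%:C) ->
  f x = l.
Proof.
move=> sf Uxv holo f_oo.
(* For k the conjugate of [f x - l] this says that the squared modulus of [f x - l] is at most 0. *)
suff Re_le0 k : Re (k * (f x - l)) <= 0.
  apply/eqP; rewrite -subr_eq0; have := Re_le0 ((f x - l)^*)%C.
  case: (f x - l) => a b /=.
  rewrite mulNr opprK -!expr2 => ab.
  have a2 := sqr_ge0 a; have b2 := sqr_ge0 b.
  have /eqP : a ^+ 2 = 0 by lra.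
  have /eqP : b ^+ 2 = 0 by lra.
  by rewrite !sqrf_eq0 eq_complex /= => -> ->.
(* Re (k (f - l)) is harmonic on the line and tends to 0 at infinity. *)
pose p := plane x v ('i *: v).
have pE s t : p s t = x + (s +i* t) *: v.
  rewrite /p /plane scalerA -addrA -scalerDl; congr (x + _ *: v).
  by apply: complex_eq => /=; lra.
have Up s t : U (p s t) by rewrite pE.
(* The shift [g] will be [l] for [f] itself and 0 for its first derivatives. *)
have dmul g t c m : is_cderive t c m ->
    is_derive t 1 (fun s => Re (k * (c s - g))) (Re (k * m)).
  move=> cm; have := is_cderiveM (is_cderive_cst t k)
    (is_cderiveD cm (is_cderive_cst t (- g))).
  by rewrite mul0r add0r addr0 => -[].
pose v' := 'i *: v.
have sv := smooth_real_derive v sf; have sv' := smooth_real_derive v' sf.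
have := @harmonic_le0 R (fun s t => Re (k * (f (p s t) - l)))
  (fun s t => Re (k * real_derive v f (p s t)))
  (fun s t => Re (k * real_derive v' f (p s t)))
  (fun s t => Re (k * real_derive v (real_derive v f) (p s t)))
  (fun s t => Re (k * real_derive v' (real_derive v' f) (p s t))).
rewrite /p plane00; apply.
- move=> s t.
  have d1 := dmul l _ _ _ (plane_derive1 sf (Up s t)).
  have d2 := dmul l _ _ _ (plane_derive2 sf (Up s t)).
  have d11 := dmul 0 _ _ _ (plane_derive1 sv (Up s t)).
  have d22 := dmul 0 _ _ _ (plane_derive2 sv' (Up s t)).
  split; [exact: d1|exact: d2| |].
    by under eq_fun do rewrite -[real_derive _ _ _]subr0; exact: d11.
  by under eq_fun do rewrite -[real_derive _ _ _]subr0; exact: d22.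
- move=> s t; rewrite -raddfD -mulrDr (laplace_eq0 sf holo (Up s t)).
  by rewrite mulr0.
- move=> q; have fc : {for q, continuous (fun q : R * R => f (p q.1 q.2))}.
    apply: (@continuous_comp _ _ _ (fun st : R * R => p st.1 st.2) f).
      exact: plane_continuous.
    exact: smooth_continuous sf (Up _ _).
  have kc : {for q, continuous (fun q : R * R => k * (f (p q.1 q.2) - l))}.
    have cc z : {for q, continuous (fun=> z : R[i])} by exact: cst_continuous.
    have fl := @continuousB _ _ _ _ _ _ fc (cc l).
    exact: (@continuousM _ _ _ _ _ (cc k) fl).
  exact: continuous_comp kc (@Re_continuous R _).
- move=> e e0.
  (* Adding 1 to the modulus keeps [N] positive when [k = 0], so that [e / N] is a valid tolerance
     for [f]. *)
  have [N N0 kN] : exists2 N : R, 0 < N & `|k| <= N%:C.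
    exists (Re `|k| + 1); first by rewrite normc_def /= ltr_wpDl ?sqrtr_ge0.
    by rewrite normc_def lecR /= lerDl.
  have [r fr] := f_oo _ (divr_gt0 e0 N0).
  exists r => s t rst.
  have rw : r%:C <= `|s +i* t|.
    case: rst => rst.
      by apply: le_trans (normc_ge_Re _); rewrite lecR.
    by apply: le_trans (normc_ge_Im _); rewrite lecR.
  have := fr _ rw; rewrite -pE => {}fr.
  rewrite -lecR; apply: le_trans (_ : `|k * (f (p s t) - l)| <= _).
    by apply: le_trans (normc_ge_Re _); rewrite lecR ler_norm.
  rewrite normrM; apply: le_trans (ler_pM _ _ kN fr) _ => //.
  by rewrite -rmorphM lecR /= mulrCA divff ?mulr1 // gt_eqF.
Qed.

End entire_functions.

(** * Functions homogeneous along the fibres *)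

Section wirtinger_functions.
Context {R : realType} {V : normedModType R[i]} (U : set V) (oU : open U).
Implicit Types (f g : V -> R[i]) (v x : V).

Lemma wirtinger_eq_on f g v x : U x -> (forall y, U y -> f y = g y) ->
  wirtinger v f x = wirtinger v g x /\
  wirtinger_bar v f x = wirtinger_bar v g x.
Proof.
move=> Ux fg.
by rewrite /wirtinger /wirtinger_bar !(real_derive_eq_on _ oU Ux fg).
Qed.

Lemma real_derive_cst v x (k : R[i]) : real_derive v (fun=> k) x = 0.
Proof. exact/is_rderiveE/is_rderive_cst. Qed.

Lemma wirtinger_cst v x (k : R[i]) :
  wirtinger v (fun=> k) x = 0 /\ wirtinger_bar v (fun=> k) x = 0.
Proof.
by rewrite /wirtinger /wirtinger_bar !real_derive_cst mulr0 subr0 addr0 mul0r.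
Qed.

Lemma wirtinger_barD f g v x : smooth_on U f -> smooth_on U g -> U x ->
  wirtinger_bar v (fun y => f y + g y) x =
  wirtinger_bar v f x + wirtinger_bar v g x.
Proof.
move=> sf sg Ux; rewrite /wirtinger_bar !(real_deriveD _ sf sg Ux).
move: (real_derive v f x) (real_derive v g x) => A B.
by move: (real_derive _ _ _) (real_derive _ _ _) => C D; ring.
Qed.

Lemma wirtinger_bar_sum (I : Type) (r : seq I) (F : I -> V -> R[i]) v x :
  (forall k, smooth_on U (F k)) -> U x ->
  wirtinger_bar v (fun y => \sum_(k <- r) F k y) x =
  \sum_(k <- r) wirtinger_bar v (F k) x.
Proof.
move=> sF Ux; elim: r => [|k r IH].
  by under eq_fun do rewrite big_nil; rewrite big_nil (wirtinger_cst _ _ _).2.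
under eq_fun do rewrite big_cons.
by rewrite big_cons -IH wirtinger_barD //; exact: smooth_sum.
Qed.

Lemma wirtinger_barM f g v x : smooth_on U f -> smooth_on U g -> U x ->
  wirtinger_bar v (fun y => f y * g y) x =
  wirtinger_bar v f x * g x + f x * wirtinger_bar v g x.
Proof.
move=> sf sg Ux; rewrite /wirtinger_bar.
have D w := is_rderiveE
  (is_rderiveM (smooth_is_rderive w sf Ux) (smooth_is_rderive w sg Ux)).
rewrite !D.
move: (real_derive v f x) (real_derive v g x) => A B.
by move: (real_derive _ _ _) (real_derive _ _ _) (f x) (g x) => C D' F G; ring.
Qed.

Lemma smooth_linear f : continuous f ->
  (forall x v (t : R), f (x + t%:C *: v) = f x + t%:C * f v) -> smooth_on U f.
Proof.
move=> cf lf ds; have D v x : is_rderive v f x (f v).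
  rewrite /is_rderive; under eq_fun do rewrite lf.
  rewrite -[X in is_cderive _ _ X]add0r.
  apply: is_cderiveD; [exact: is_cderive_cst|exact: is_cderive_lin].
(* The last direction of the list is differentiated first; it already leaves the constant [f v]. *)
case/lastP: ds => [|ds v] x Ux /=.
  by split; [exact: cf|move=> v; exact: is_rderive_derivable (D v x)].
have -> : foldr real_derive f (rcons ds v) = foldr real_derive (fun=> f v) ds.
  rewrite foldr_rcons; congr foldr; apply/funext => y; exact: is_rderiveE.
exact: (smooth_cst (U := U)).
Qed.

End wirtinger_functions.

Lemma fst_continuous (S T : topologicalType) : continuous (fst : S * T -> S).
Proof. by move=> x; exact: cvg_fst. Qed.

Lemma snd_continuous (S T : topologicalType) : continuous (snd : S * T -> T).
Proof. by move=> x; exact: cvg_snd. Qed.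

(** * Scaling of the fibres and Euler's identity *)

Section homogeneous_functions.
Context {R : realType} {n : nat} (D : set 'rV[R[i]]_n) (oD : open D).
Local Notation V := ('rV[R[i]]_n * 'rV[R[i]]_n)%type.
Implicit Types (f g : V -> R[i]) (v w x : V) (c : R[i]) (chi : R[i] -> R[i]).

Let U : set V := [set x | D x.1 /\ x.2 != 0].

Lemma open_slit : open U.
Proof.
have -> : U = fst @^-1` D `&` snd @^-1` ~` [set 0].
  by apply/seteqP; split => x /= [Dx x0]; split => //; exact/eqP.
apply: openI; apply: open_comp => //.
  by move=> x _; exact: fst_continuous.
  by move=> x _; exact: snd_continuous.
apply/closed_openC/accessible_closed_set1/hausdorff_accessible.
exact: norm_hausdorff.
Qed.

(** Applied to points and also to directions, since the map is linear and so is its own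
    differential. *)
Definition scale_fibre c x : V := (x.1, c *: x.2).

Lemma scale_fibre_slit c x : c != 0 -> U x -> U (scale_fibre c x).
Proof. by move=> c0 [Dx x0]; split => //=; rewrite scaler_eq0 negb_or c0. Qed.

(** A multiplier [chi] replaces an integer degree, because [L] and its conjugate derivatives scale
    by expressions in [c] and [c^*]. *)
Definition homogeneous chi f :=
  forall c x, c != 0 -> U x -> f (scale_fibre c x) = chi c * f x.

(** Scaling maps the line through [x] along [v] to the line through the scaled point along the
    scaled direction, and [f] gets multiplied by [chi c]. *)
Lemma homogeneous_real_derive chi f c x v : homogeneous chi f ->
  smooth_on U f -> c != 0 -> U x ->
  real_derive (scale_fibre c v) f (scale_fibre c x) = chi c * real_derive v f x.
Proof.
move=> hf sf c0 Ux; apply: is_rderiveE; rewrite /is_rderive.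
have := is_cderiveM (is_cderive_cst 0 (chi c)) (smooth_is_rderive v sf Ux).
rewrite mul0r add0r; apply: is_cderive_near.
have : U (x + (0 : R)%:C *: v) by rewrite scale0r addr0.
move=> /(line_near open_slit); apply: filterS => t Ut.
rewrite -hf //; congr (f (_, _)) => /=.
by rewrite scalerDr !scalerA mulrC.
Qed.

Lemma homogeneous_wirtinger chi f c x v : homogeneous chi f ->
  smooth_on U f -> c != 0 -> U x ->
  wirtinger (scale_fibre c v) f (scale_fibre c x) = chi c * wirtinger v f x /\
  wirtinger_bar (scale_fibre c v) f (scale_fibre c x) =
    chi c * wirtinger_bar v f x.
Proof.
move=> hf sf c0 Ux; rewrite /wirtinger /wirtinger_bar.
have -> : 'i *: scale_fibre c v = scale_fibre c ('i *: v).
  by congr (_, _) => /=; rewrite !scalerA mulrC.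
rewrite !(homogeneous_real_derive _ hf) //.
move: (chi c) (real_derive _ _ _) (real_derive _ _ _) => k A B.
by split; ring.
Qed.

(** Fibre scaling fixes the directions of the base, so the multiplier is unchanged. *)
Lemma homogeneous_d_z chi f k : homogeneous chi f -> smooth_on U f ->
  homogeneous chi (d_z k f).
Proof.
move=> hf sf c x c0 Ux; rewrite /d_z -(homogeneous_wirtinger _ hf sf c0 Ux).1.
by rewrite /scale_fibre /= scaler0.
Qed.

Lemma scale_fibre_vertical c (eta : 'rV[R[i]]_n) :
  scale_fibre c (0, eta) = c *: (0, eta).
Proof. by rewrite [RHS]surjective_pairing /= scaler0. Qed.

(** A vertical direction is itself multiplied by [c]; pulling this factor out by complex linearity
    divides the multiplier by [c]. *)
Lemma homogeneous_d_eta chi f k : homogeneous chi f -> smooth_on U f ->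
  homogeneous (fun c => c^-1 * chi c) (d_eta k f).
Proof.
move=> hf sf c x c0 Ux; have cx := scale_fibre_slit c0 Ux.
have [+ _] := homogeneous_wirtinger (0, delta_mx 0 k) hf sf c0 Ux.
rewrite scale_fibre_vertical (wirtinger_scalev open_slit _ _ sf cx).1 => E.
by rewrite -mulrA -[in RHS]E mulKf.
Qed.

Lemma homogeneous_d_etabar chi f k : homogeneous chi f -> smooth_on U f ->
  homogeneous (fun c => c^*^-1 * chi c) (d_etabar k f).
Proof.
move=> hf sf c x c0 Ux; have cx := scale_fibre_slit c0 Ux.
have [_] := homogeneous_wirtinger (0, delta_mx 0 k) hf sf c0 Ux.
rewrite scale_fibre_vertical (wirtinger_scalev open_slit _ _ sf cx).2 => E.
by rewrite -mulrA -[in RHS]E mulKf // conjC_eq0.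
Qed.

Lemma homogeneous_eq chi chi' f : homogeneous chi f ->
  (forall c, c != 0 -> chi c = chi' c) -> homogeneous chi' f.
Proof. by move=> hf E c x c0 Ux; rewrite -E // hf. Qed.

Lemma homogeneousM chi chi' f g : homogeneous chi f -> homogeneous chi' g ->
  homogeneous (fun c => chi c * chi' c) (fun x => f x * g x).
Proof. by move=> hf hg c x c0 Ux; rewrite hf // hg // mulrACA. Qed.

Lemma homogeneous_sum chi (I : Type) (r : seq I) (F : I -> V -> R[i]) :
  (forall k, homogeneous chi (F k)) ->
  homogeneous chi (fun x => \sum_(k <- r) F k x).
Proof.
by move=> hF c x c0 Ux; rewrite mulr_sumr; apply: eq_bigr => k _; exact: hF.
Qed.

Lemma homogeneous_coord k : homogeneous id (fun x => x.2 0 k).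
Proof. by move=> c x _ _; rewrite /= mxE. Qed.

Lemma coord2_continuous k : continuous (fun x : V => x.2 0 k).
Proof.
move=> x; have cM : {for x.2, continuous (fun M : 'rV[R[i]]_n => M 0 k : R[i])}.
  exact: coord_continuous.
exact: (continuous_comp (@snd_continuous _ _ x) cM).
Qed.

Lemma coord2_line k x v (t : R) :
  (x + t%:C *: v).2 0 k = x.2 0 k + t%:C * v.2 0 k.
Proof. by rewrite !mxE. Qed.

Lemma smooth_coord k : smooth_on U (fun x => x.2 0 k).
Proof. exact: (smooth_linear (@coord2_continuous k) (coord2_line k)). Qed.

Lemma wirtinger_bar_coord k v x : wirtinger_bar v (fun y => y.2 0 k) x = 0.
Proof.
have dE w : real_derive w (fun y => y.2 0 k) x = w.2 0 k.
  apply: is_rderiveE; rewrite /is_rderive.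
  under eq_fun do rewrite coord2_line.
  rewrite -[X in is_cderive _ _ X]add0r.
  by apply: is_cderiveD; [exact: is_cderive_cst|exact: is_cderive_lin].
by rewrite /wirtinger_bar !dE mxE mulrA i_mul_i mulN1r subrr mul0r.
Qed.

Lemma fibre_direction (eta : 'rV[R[i]]_n) :
  (0, eta) = \sum_k eta 0 k *: (0, delta_mx 0 k) :> V.
Proof.
rewrite [RHS]surjective_pairing; congr (_, _).
  by rewrite raddf_sum big1 // => k _; rewrite /= scaler0.
by rewrite raddf_sum /=; exact: row_sum_delta.
Qed.

(** The sum is the Wirtinger derivative along the fibre vector eta. Along c eta, [f] equals (1 +
    tc)^m [f x], with derivative m c [f x] at t = 0; the cases c = 1 and c = i are combined. *)
Lemma euler f m x : homogeneous (fun c => c ^+ m) f -> smooth_on U f -> U x ->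
  \sum_k x.2 0 k * d_eta k f x = m%:R * f x.
Proof.
move=> hf sf Ux.
rewrite -(wirtinger_sumv open_slit _ _ _ sf Ux).1 -fibre_direction.
have dE c : real_derive (c *: (0, x.2)) f x = m%:R * c * f x.
  apply: is_rderiveE; rewrite /is_rderive.
  have dX : is_cderive 0 (fun t : R => (1 + t%:C * c) ^+ m) (m%:R * c).
    have d1 : is_cderive 0 (fun t : R => 1 + t%:C * c) c.
      rewrite -[X in is_cderive _ _ X]add0r.
      apply: is_cderiveD; [exact: is_cderive_cst|exact: is_cderive_lin].
    elim: (m) => [|k IH].
      by rewrite mul0r; under eq_fun do rewrite expr0; exact: is_cderive_cst.
    under eq_fun do rewrite exprS.
    have := is_cderiveM d1 IH; rewrite mul0r addr0 expr1n mulr1 mul1r.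
    by rewrite -[X in X + _]mul1r -mulrDl -mulrS.
  have := is_cderiveM dX (is_cderive_cst 0 (f x)).
  rewrite mulr0 addr0; apply: is_cderive_near.
  have : U (x + (0 : R)%:C *: (c *: (0, x.2))) by rewrite scale0r addr0.
  (* For t near 0 the point stays off the zero section, which forces 1 + tc to be nonzero, as
     homogeneity requires. *)
  move=> /(line_near open_slit); apply: filterS => t [_].
  have E : x + t%:C *: (c *: (0, x.2)) = scale_fibre (1 + t%:C * c) x.
    rewrite [LHS]surjective_pairing; congr (_, _) => /=.
      by rewrite !scaler0 addr0.
    by rewrite scalerDl scale1r scalerA.
  rewrite E /= scaler_eq0 negb_or => /andP[c0 _].
  by rewrite hf.
have dE1 := dE 1; rewrite scale1r in dE1; rewrite /wirtinger dE1 dE.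
have E (A j : R[i]) : m%:R * 1 * A - j * (m%:R * j * A) =
    (1 - j * j) * (m%:R * A) by ring.
by rewrite E i_mul_i opprK mulrAC divff ?mul1r // pnatr_eq0.
Qed.

Lemma euler_holomorphic f m x : (0 < m)%N ->
  homogeneous (fun c => c ^+ m) f -> smooth_on U f ->
  forall l, (forall k y, U y -> d_etabar l (d_eta k f) y = 0) -> U x ->
  d_etabar l f x = 0.
Proof.
move=> m0 hf sf l hol Ux.
have sk k : smooth_on U (d_eta k f) by exact: (smooth_wirtinger open_slit).
have sc := smooth_coord.
have fE y : U y -> f y = \sum_k m%:R^-1 * (y.2 0 k * d_eta k f y).
  by move=> Uy; rewrite -mulr_sumr (euler hf sf Uy) mulKf // pnatr_eq0 -lt0n.
have syk k : smooth_on U (fun y => y.2 0 k * d_eta k f y).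
  exact: (smoothM open_slit (sc k) (sk k)).
rewrite /d_etabar (wirtinger_eq_on open_slit _ Ux fE).2.
have sF k := smoothZ open_slit m%:R^-1 (syk k).
rewrite (wirtinger_bar_sum open_slit _ _ sF Ux).
apply: big1 => k _.
rewrite (wirtinger_barM _ (smooth_cst _) (syk k)) //.
rewrite (wirtinger_barM _ (sc k) (sk k)) //.
have := hol k x Ux; rewrite /d_etabar => ->.
by rewrite (wirtinger_cst _ _ _).2 wirtinger_bar_coord !(mul0r, mulr0, addr0).
Qed.

End homogeneous_functions.

(** * Holomorphic functions of degree 0 on the fibres *)

Section degree_zero.
Context {R : realType} {n : nat} (D : set 'rV[R[i]]_n) (oD : open D).
Local Notation V := ('rV[R[i]]_n * 'rV[R[i]]_n)%type.
Let U : set V := [set x | D x.1 /\ x.2 != 0].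

Lemma complex_line_continuous (x v : V) :
  continuous (fun c : R[i] => x + c *: v).
Proof.
move=> c; have c1 : {for c, continuous (fun=> x)} by exact: cst_continuous.
exact: (@continuousD _ _ _ _ _ _ c1 (@scalel_continuous _ _ v c)).
Qed.

(** Such a function descends to the projective space of the fibre; it is shown to be constant on the
    projective line through the two points. *)
Lemma holomorphic_degree0_cst (h : V -> R[i]) z eta eta' :
  homogeneous D (fun=> 1) h -> smooth_on U h ->
  (forall l y, U y -> d_etabar l h y = 0) ->
  U (z, eta) -> U (z, eta') -> h (z, eta) = h (z, eta').
Proof.
move=> hh sh hol Ue Ue'.
have [[c ce]|indep] := pselect (exists c, eta = c *: eta').
  have c0 : c != 0.
    by apply: contraTneq Ue.2 => c0; rewrite /= ce c0 scale0r eqxx.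
  by rewrite ce (hh c (z, eta')) // mul1r.
have lineE w : (z, eta) + w *: (0, eta') = (z, eta + w *: eta').
  by rewrite [LHS]surjective_pairing /= scaler0 addr0.
(* As [eta] is not a multiple of [eta'], the complex line avoids the zero section. *)
have Uw w : U (z, eta + w *: eta').
  split; first exact: Ue.1.
  apply/negP; rewrite /= addr_eq0 -scaleNr => /eqP e0.
  by apply: indep; exists (- w).
apply: (@entire_limit _ _ _ (open_slit oD) _ _ (0, eta') _ sh).
- by move=> w; rewrite lineE; exact: Uw.
- move=> y Uy; rewrite fibre_direction.
  rewrite (wirtinger_sumv (open_slit oD) _ _ _ sh Uy).2 big1 // => k _.
  by have := hol k y Uy; rewrite /d_etabar => ->; rewrite mulr0.
(* Dividing by w turns the value at [eta + w *: eta'] into [g w^-1], so the limit at infinity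
   follows from continuity of [g] at 0. *)
move=> e e0; pose g c := h ((z, eta') + c *: (0, eta)).
have gE c : g c = h (z, eta' + c *: eta).
  by rewrite /g; congr h; rewrite [LHS]surjective_pairing /= scaler0 addr0.
have cg : {for 0, continuous g}.
  apply: (continuous_comp (@complex_line_continuous _ _ 0)).
  by rewrite scale0r addr0; exact: smooth_continuous sh Ue'.
have e0' : (0 : R[i]) < e%:C by rewrite ltcR.
have [d /= d0 dg] := (nbhs_ballP _ _).1
  ((@cvgrPdist_lt _ _ _ (nbhs (0 : R[i])) _ g (g 0)).1 cg _ e0').
(* The radius [d] is a positive element of [R[i]], hence real; adding 1 makes the inequality between
   [d^-1] and the modulus of w strict. *)
exists (complex.Re d^-1 + 1) => w rw.
have dw : d^-1 < `|w|.
  apply: lt_le_trans rw; move: d0.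
  rewrite -invr_gt0 !ltcE /= => /andP[/eqP -> _].
  by rewrite eqxx ltrDl ltr01.
have w0 : w != 0 by rewrite -normr_gt0 (lt_trans _ dw) // invr_gt0.
rewrite lineE.
have -> : h (z, eta + w *: eta') = g w^-1.
  rewrite gE -[RHS]mul1r -(hh w) //; last first.
    split; first exact: Ue.1.
    have := (Uw w).2; apply: contra => /= /eqP E.
    by rewrite -(scale1r eta) -(mulfV w0) -scalerA -scalerDr addrC E scaler0.
  congr (h (_, _)); rewrite /= scalerDr scalerA mulfV // scale1r.
  by rewrite addrC.
have g0 : g 0 = h (z, eta') by rewrite gE scale0r addr0.
rewrite -g0 distrC; apply/ltW/dg.
rewrite -ball_normE /= sub0r normrN normfV.
by rewrite -[ltRHS]invrK ltf_pV2 // posrE ?invr_gt0 // normr_gt0.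
Qed.

End degree_zero.

(** * The spray of a complex Finsler space *)

Section complex_finsler.
Context {R : realType} {n : nat} {M : complexManifold R n}.
Context (F : complexFinsler M) (a : atlas M).
Local Notation V := ('rV[R[i]]_n * 'rV[R[i]]_n)%type.
Local Notation L := (finsler_L F a).
Local Notation D := (chart_image a).

Let oD : open D := @chart_image_open _ _ M a.
Let oU : open (slit a) := open_slit oD.
Let sL : smooth_on (slit a) (fun x => (L x)%:C) :=
  @finsler_smooth _ _ _ F a.

Lemma homogeneous_L : homogeneous D (fun c => `|c| ^+ 2) (fun x => (L x)%:C).
Proof.
move=> c [z eta] c0 [Dz _].
have hF := @finsler_homogeneous _ _ _ F a z eta c Dz.
by rewrite /finsler_L !rmorphXn /= hF exprMn.
Qed.

Let metricE i j x :
  metric L x i j = d_eta i (d_etabar j (fun y => (L y)%:C)) x.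
Proof. by rewrite /metric mxE. Qed.

Let s_metric i j : smooth_on (slit a) (fun x => metric L x i j).
Proof.
under eq_fun do rewrite metricE.
exact/(smooth_wirtinger oU)/(smooth_wirtinger_bar oU).
Qed.

(** The multiplier of [L] is c times its conjugate; [d_etabar] removes one factor and [d_eta] the
    other. *)
Lemma homogeneous_metric i j :
  homogeneous D (fun=> 1) (fun x => metric L x i j).
Proof.
have h1 := homogeneous_d_etabar oD j homogeneous_L sL.
have h2 := homogeneous_d_eta oD i h1 (smooth_wirtinger_bar oU _ sL).
have -> : (fun x => metric L x i j) =
    d_eta i (d_etabar j (fun y => (L y)%:C)).
  by apply/funext => x; exact: metricE.
apply: homogeneous_eq h2 _ => c c0; rewrite normCK.
have cc0 : c^* != 0 by rewrite conjC_eq0.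
by rewrite [X in _ * (_ * X)]mulrC mulKf // mulVf.
Qed.

(** On a nonzero row vector killed by the matrix, the Hermitian form would vanish, against positive
    definiteness. *)
Lemma metric_unit x : slit a x -> metric L x \in unitmx.
Proof.
move=> Ux; rewrite unitmxE unitfE; apply/negP => /det0P[v v0 vg].
have := @finsler_posdef _ _ _ F a x Ux v v0.
rewrite exchange_big big1 ?ltxx // => j _.
rewrite -mulr_suml.
have := congr1 (fun A : 'rV_n => A 0 j) vg; rewrite !mxE => E.
by under eq_bigr do rewrite mulrC; rewrite E mul0r.
Qed.

Let s_metric_inv i j : smooth_on (slit a) (fun x => metric_inv L x i j).
Proof. exact: (smooth_invmx oU i j metric_unit s_metric). Qed.

Lemma homogeneous_metric_inv i j :
  homogeneous D (fun=> 1) (fun x => metric_inv L x i j).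
Proof.
move=> c x c0 Ux; have E : metric L (scale_fibre c x) = metric L x.
  apply/matrixP => k l.
  exact: etrans (homogeneous_metric k l c0 Ux) (mul1r _).
exact: etrans (congr1 (fun A : 'M[R[i]]_n => invmx A i j) E) (esym (mul1r _)).
Qed.

Let s_N i j : smooth_on (slit a) (N_coef L i j).
Proof.
apply: (smooth_sum oU) => m _; apply: (smooth_sum oU) => l _.
apply: (smoothM oU); last exact: smooth_coord.
apply: (smoothM oU); first exact: s_metric_inv.
exact/(smooth_wirtinger oU)/s_metric.
Qed.

Lemma homogeneous_N i j : homogeneous D id (N_coef L i j).
Proof.
apply: homogeneous_sum => m; apply: homogeneous_sum => l.
have hz := homogeneous_d_z oD j (homogeneous_metric l m) (s_metric l m).
have := homogeneousM (homogeneousM (homogeneous_metric_inv m i) hz)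
  (homogeneous_coord l).
by move=> /homogeneous_eq; apply => c _; rewrite !mul1r.
Qed.

Lemma smooth_spray i : smooth_on (slit a) (spray L i).
Proof.
apply: (smoothM oU); first exact: smooth_cst.
apply: (smooth_sum oU) => j _; apply: (smoothM oU); first exact: s_N.
exact: smooth_coord.
Qed.

Lemma homogeneous_spray i : homogeneous D (fun c => c ^+ 2) (spray L i).
Proof.
have h : homogeneous D (fun c => c * c)
    (fun x => \sum_j N_coef L i j x * x.2 0 j).
  apply: homogeneous_sum => j.
  exact: homogeneousM (homogeneous_N i j) (homogeneous_coord j).
by move=> c x c0 Ux; rewrite /spray (h c x c0 Ux) mulrCA expr2.
Qed.

Lemma smooth_Nc i j : smooth_on (slit a) (Nc_coef L i j).
Proof. exact/(smooth_wirtinger oU)/smooth_spray. Qed.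

Lemma homogeneous_Nc i j : homogeneous D (fun c => c ^+ 1) (Nc_coef L i j).
Proof.
have := homogeneous_d_eta oD j (homogeneous_spray i) (smooth_spray i).
by move=> /homogeneous_eq; apply => c c0; rewrite expr2 mulKf.
Qed.

Lemma mixed_of_spray_holomorphic i j k x : slit a x ->
  (forall y, slit a y -> d_etabar k (spray L i) y = 0) ->
  d_etabar k (Nc_coef L i j) x = 0.
Proof.
move=> Ux hol; rewrite /d_etabar /Nc_coef /d_eta.
rewrite (wirtingerC oU _ _ (smooth_spray i) Ux).
by rewrite (wirtinger_eq_on oU _ Ux hol).1 (wirtinger_cst _ _ _).1.
Qed.

Lemma spray_holomorphic_of_mixed i k x : slit a x ->
  (forall j y, slit a y -> d_etabar k (Nc_coef L i j) y = 0) ->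
  d_etabar k (spray L i) x = 0.
Proof.
move=> Ux hol.
exact: (euler_holomorphic oD _ (homogeneous_spray i) (smooth_spray i) hol Ux).
Qed.

Lemma horizontal_coef_cst i j k z eta eta' :
  (forall l y, slit a y -> d_etabar l (spray L i) y = 0) ->
  slit a (z, eta) -> slit a (z, eta') ->
  d_eta k (Nc_coef L i j) (z, eta) = d_eta k (Nc_coef L i j) (z, eta').
Proof.
move=> hol Ue Ue'.
apply: (holomorphic_degree0_cst oD _ _ _ Ue Ue').
- have := homogeneous_d_eta oD k (homogeneous_Nc i j) (smooth_Nc i j).
  by move=> /homogeneous_eq; apply => c c0; rewrite expr1 mulVf.
- exact/(smooth_wirtinger oU)/smooth_Nc.
- move=> l y Uy; rewrite /d_etabar /d_eta.
  rewrite (wirtingerC oU _ _ (smooth_Nc i j) Uy).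
  have h y' : slit a y' -> d_etabar l (Nc_coef L i j) y' = 0.
    by move=> Uy'; apply: mixed_of_spray_holomorphic Uy' (hol l).
  by rewrite (wirtinger_eq_on oU _ Uy h).1 (wirtinger_cst _ _ _).1.
Qed.

(** Constancy on the fibres kills every vertical real derivative of the horizontal coefficients,
    hence their conjugate derivatives; Euler's identity in degree 1 passes this on to [Nc_coef]. *)
Lemma mixed_of_horizontal_cst i j l x : slit a x ->
  (forall k z eta eta', slit a (z, eta) -> slit a (z, eta') ->
    d_eta k (Nc_coef L i j) (z, eta) = d_eta k (Nc_coef L i j) (z, eta')) ->
  d_etabar l (Nc_coef L i j) x = 0.
Proof.
move=> Ux cst.
apply: (euler_holomorphic oD _ (homogeneous_Nc i j) (smooth_Nc i j) _ Ux) => //.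
move=> k y Uy.
have D0 eta : real_derive (0, eta) (d_eta k (Nc_coef L i j)) y = 0.
  apply: is_rderiveE; rewrite /is_rderive.
  apply: is_cderive_near (is_cderive_cst 0 (d_eta k (Nc_coef L i j) y)).
  have : slit a (y + (0 : R)%:C *: (0, eta)) by rewrite scale0r addr0.
  move=> /(line_near oU); apply: filterS => t.
  have -> : y + t%:C *: (0, eta) = (y.1, y.2 + t%:C *: eta).
    by rewrite [LHS]surjective_pairing /= scaler0 addr0.
  by move: Uy; rewrite {1 2}[y]surjective_pairing => Uy Ut; exact: cst.
rewrite /d_etabar /wirtinger_bar D0.
have -> : 'i *: (0, delta_mx 0 l) = (0, 'i *: delta_mx 0 l) :> V.
  by rewrite [LHS]surjective_pairing /= scaler0.
by rewrite D0 mulr0 addr0 mul0r.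
Qed.

End complex_finsler.

Theorem theorem3p6 (R : realType) (n : nat) (M : complexManifold R n)
    (F : complexFinsler M) :
  (generalized_berwald F <-> spray_holomorphic_in_eta F) /\
  (spray_holomorphic_in_eta F <-> berwald_connection_type10 F).
Proof.
(* Proved first because the implication from (i) to (ii) also goes through (iii). *)
have iii_ii : berwald_connection_type10 F -> spray_holomorphic_in_eta F.
  move=> h a i k x Ux; apply: (spray_holomorphic_of_mixed Ux) => j y Uy.
  exact: (h a i j k y Uy).
split; split; last exact: iii_ii.
- move=> h; apply: iii_ii => a i j l x Ux.
  by apply: (mixed_of_horizontal_cst _ Ux) => k; exact: (h a i j k).
- move=> h a i j k z eta eta' Ue Ue'.
  by apply: (horizontal_coef_cst _ _ _ Ue Ue') => l y; exact: (h a i l y).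
- move=> h a i j k x Ux.
  by apply: (mixed_of_spray_holomorphic _ Ux) => y; exact: (h a i k y).
Qed.
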